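(* Assume that $V$ is a vertex super-algebra. Then $$\widetilde{U}(V)=\widetilde{U}(V)^{+}\otimes\widetilde{U}(V)^{0}\widetilde{U}(V)^{-}$$ as a vector space; that is, the multiplication map $\widetilde{U}(V)^{+}\otimes\widetilde{U}(V)^{0}\widetilde{U}(V)^{-}\to\widetilde{U}(V)$ is a linear isomorphism.
   Context: All vector spaces are over $\mathbb{C}$. A vertex super-algebra is a $\mathbb{Z}/2$-graded space $V=V_{\bar0}\oplus V_{\bar1}$ with vertex operator map $Y(v,x)=\sum_{n}v_nx^{-n-1}$ and vacuum $\mathbf{1}$ satisfying the usual axioms with the super Jacobi identity (sign $(-1)^{|u||v|}$); $\mathcal{D}v=v_{-2}\mathbf{1}$. It is a weak quantum vertex algebra with constant $\mathcal{S}$-map $\mathcal{S}(v\otimes u)=(-1)^{|u||v|}v\otimes u$ for homogeneous $u,v$. $\widetilde{U}(V)$ is the associative algebra with generators $u[n]$ (linear in $u$), $u\in V$, $n\in\mathbb{Z}$, subject to relations $\mathbf{1}[n]=\delta_{n,0}$, $(\mathcal{D}u)[n]=-nu[n]$, and, for homogeneous $u,v\in V$ and $m,n\in\mathbb{Z}$, $$u[m]v[n]-(-1)^{|u||v|}v[n]u[m]=\sum_{j\ge0}\frac{m^j}{j!}(u_jv)[m+n].$$ $\widetilde{U}(V)^0$ is the subalgebra generated by all $u[0]$, $u\in V$; $\widetilde{U}(V)^{\pm}$ is the subalgebra generated by all $u[\mp n]$, $u\in V$, $n\ge1$; and $\widetilde{U}(V)^{0}\widetilde{U}(V)^{-}$,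 the span of products, is the subalgebra generated by all $u[n]$ with $n\ge0$. *)

(* Defs.v *)
From HB Require Import structures.
From mathcomp Require Import all_boot all_order all_algebra.
From mathcomp Require Import finmap monalg complex.
From mathcomp Require Import boolp classical_sets fsbigop reals.

Set Implicit Arguments.
Unset Strict Implicit.
Unset Printing Implicit Defensive.

Import Order.TTheory GRing.Theory Num.Theory.
Local Open Scope ring_scope.
Local Open Scope classical_set_scope.
Local Open Scope quotient_scope.

Definition is_subspace (K : pzRingType) (M : lmodType K) (A : set M) : Prop :=
  A 0 /\ forall (a : K) (u v : M), A u -> A v -> A (a *: u + v).

Section Span.
Context {K : pzRingType} {M : lmodType K}.

Definition span (S : set M) : {pred M} :=
  fun x => `[< smallest (@is_subspace K M) S x >].

Fact span_submod_closed (S : set M) : submod_closed (span S).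
Proof.
split=> [|a u v /asboolP hu /asboolP hv]; apply/asboolP => A [AS SA].
  by case: AS.
by case: (AS) => _; apply; [apply: hu | apply: hv].
Qed.

HB.instance Definition _ (S : set M) :=
  GRing.isSubmodClosed.Build K M (span S) (span_submod_closed S).

Lemma mem_span (S : set M) x : S x -> x \in span S.
Proof. by move=> Sx; apply/asboolP => A [_]; apply. Qed.

Lemma span_sub (S : set M) (A : set M) :
  is_subspace A -> S `<=` A -> forall x, x \in span S -> A x.
Proof. by move=> As SA x /asboolP; apply. Qed.

Record subsp (W : submodClosed M) : predArgType :=
  Subsp { subsp_val : M; subsp_mem : subsp_val \in W }.

HB.instance Definition _ (W : submodClosed M) := [isSub for @subsp_val W].
HB.instance Definition _ (W : submodClosed M) := [Choice of subsp W by <:].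
HB.instance Definition _ (W : submodClosed M) :=
  [SubChoice_isSubLmodule of subsp W by <:].

(* submodClosed does not inherit from zmodClosed, which Quotient.quot expects. *)
Definition zmod_pred (W : submodClosed M) : {pred M} := fun x => x \in W.

Fact zmod_pred_closed (W : submodClosed M) : zmod_closed (zmod_pred W).
Proof. exact: (submodClosedP W). Qed.

HB.instance Definition _ (W : submodClosed M) :=
  GRing.isZmodClosed.Build M (zmod_pred W) (zmod_pred_closed W).

Definition quotmod (W : submodClosed M) : Type := Quotient.quot (zmod_pred W).

HB.instance Definition _ (W : submodClosed M) :=
  GRing.Zmodule.on (quotmod W).

Section QuotModule.
Variable W : submodClosed M.

Definition quot_pi (x : M) : quotmod W := \pi_(Quotient.quot (zmod_pred W)) x.
Definition quot_repr (x : quotmod W) : M := repr (x : Quotient.quot (zmod_pred W)).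

Lemma quot_reprK : cancel quot_repr quot_pi.
Proof. by move=> x; rewrite /quot_pi /quot_repr reprK. Qed.

Lemma quot_piP x y : quot_pi x = quot_pi y <-> x - y \in W.
Proof.
rewrite -[x - y \in W]/(x - y \in zmod_pred W) Quotient.idealrBE.
by split=> [/eqP|/eqP].
Qed.

Lemma quot_piB : {morph quot_pi : x y / x - y}.
Proof. by move=> x y; rewrite /quot_pi raddfB. Qed.

HB.instance Definition _ :=
  GRing.isZmodMorphism.Build M (quotmod W) quot_pi quot_piB.

Definition quot_scale (a : K) (x : quotmod W) : quotmod W :=
  quot_pi (a *: quot_repr x).

Lemma quot_piZ a x : quot_pi (a *: x) = quot_scale a (quot_pi x).
Proof.
apply/quot_piP; rewrite -scalerBr; apply: rpredZ.
by apply/quot_piP; rewrite quot_reprK.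
Qed.

Fact quot_scalerA a b x :
  quot_scale a (quot_scale b x) = quot_scale (a * b) x.
Proof. by rewrite -[x]quot_reprK -!quot_piZ scalerA. Qed.
Fact quot_scale1r : left_id 1 quot_scale.
Proof. by move=> x; rewrite -[x]quot_reprK -!quot_piZ scale1r. Qed.
Fact quot_scalerDr : right_distributive quot_scale +%R.
Proof.
move=> a x y; rewrite -[x]quot_reprK -[y]quot_reprK.
by rewrite -raddfD -!quot_piZ -raddfD scalerDr.
Qed.
Fact quot_scalerDl x : {morph quot_scale^~ x : a b / a + b}.
Proof.
by move=> a b; rewrite -[x]quot_reprK -!quot_piZ -raddfD scalerDl.
Qed.

HB.instance Definition _ := GRing.Zmodule_isLmodule.Build K (quotmod W)
  quot_scalerA quot_scale1r quot_scalerDr quot_scalerDl.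

HB.instance Definition _ :=
  GRing.isScalable.Build K M (quotmod W) *:%R quot_pi quot_piZ.
End QuotModule.
End Span.

Section QuotAlgebra.
Context {K : comNzRingType} {F : algType K}.

Definition is_ideal (A : set F) : Prop :=
  is_subspace A /\ forall x y : F, A y -> A (x * y) /\ A (y * x).

Definition ideal (S : set F) : {pred F} :=
  fun x => `[< smallest is_ideal S x >].

Fact ideal_submod_closed (S : set F) : submod_closed (ideal S).
Proof.
split=> [|a u v /asboolP hu /asboolP hv]; apply/asboolP => A [AS SA].
  by case: AS => - [].
by case: (AS) => -[_ h] _; apply: h; [apply: hu | apply: hv].
Qed.

HB.instance Definition _ (S : set F) :=
  GRing.isSubmodClosed.Build K F (ideal S) (ideal_submod_closed S).

Lemma ideal_mull S x y : y \in ideal S -> x * y \in ideal S.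
Proof.
move=> /asboolP hy; apply/asboolP => A [IA SA].
by case: (IA) => _ /(_ x y (hy A (conj IA SA))) [].
Qed.

Lemma ideal_mulr S x y : y \in ideal S -> y * x \in ideal S.
Proof.
move=> /asboolP hy; apply/asboolP => A [IA SA].
by case: (IA) => _ /(_ x y (hy A (conj IA SA))) [].
Qed.

(* The quotient may be the zero ring, hence no algType structure. *)
Definition quotalg (S : set F) : Type := quotmod (ideal S).

HB.instance Definition _ (S : set F) := GRing.Lmodule.on (quotalg S).

Section Ring.
Variable S : set F.

Definition quotalg_pi : F -> quotalg S := @quot_pi _ _ (ideal S).
Definition quotalg_repr : quotalg S -> F := @quot_repr _ _ (ideal S).

HB.instance Definition _ := GRing.Linear.on quotalg_pi.

Lemma quotalg_reprK : cancel quotalg_repr quotalg_pi.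
Proof. exact: quot_reprK. Qed.

Lemma quotalg_piP x y : quotalg_pi x = quotalg_pi y <-> x - y \in ideal S.
Proof. exact: quot_piP. Qed.

Definition quotalg_one : quotalg S := quotalg_pi 1.
Definition quotalg_mul (x y : quotalg S) : quotalg S :=
  quotalg_pi (quotalg_repr x * quotalg_repr y).

Fact quotalg_piM x y :
  quotalg_pi (x * y) = quotalg_mul (quotalg_pi x) (quotalg_pi y).
Proof.
set x' := quotalg_repr (quotalg_pi x); set y' := quotalg_repr (quotalg_pi y).
have hx : x - x' \in ideal S by apply/quotalg_piP; rewrite quotalg_reprK.
have hy : y - y' \in ideal S by apply/quotalg_piP; rewrite quotalg_reprK.
apply/quotalg_piP; have -> : x * y - x' * y' = (x - x') * y + x' * (y - y').
  by rewrite mulrBl mulrBr addrA subrK.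
by apply: rpredD; [apply: ideal_mulr | apply: ideal_mull].
Qed.

Fact quotalg_mulA : associative quotalg_mul.
Proof.
move=> x y z.
rewrite -[x]quotalg_reprK -[y]quotalg_reprK -[z]quotalg_reprK.
by rewrite -!quotalg_piM mulrA.
Qed.
Fact quotalg_mul1r : left_id quotalg_one quotalg_mul.
Proof. by move=> x; rewrite -[x]quotalg_reprK -!quotalg_piM mul1r. Qed.
Fact quotalg_mulr1 : right_id quotalg_one quotalg_mul.
Proof. by move=> x; rewrite -[x]quotalg_reprK -!quotalg_piM mulr1. Qed.
Fact quotalg_mulDl : left_distributive quotalg_mul +%R.
Proof.
move=> x y z.
rewrite -[x]quotalg_reprK -[y]quotalg_reprK -[z]quotalg_reprK.
by rewrite -raddfD -!quotalg_piM -raddfD mulrDl.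
Qed.
Fact quotalg_mulDr : right_distributive quotalg_mul +%R.
Proof.
move=> x y z.
rewrite -[x]quotalg_reprK -[y]quotalg_reprK -[z]quotalg_reprK.
by rewrite -raddfD -!quotalg_piM -raddfD mulrDr.
Qed.

HB.instance Definition _ := GRing.Zmodule_isPzRing.Build (quotalg S)
  quotalg_mulA quotalg_mul1r quotalg_mulr1 quotalg_mulDl quotalg_mulDr.

Fact quotalg_pi_monoid : monoid_morphism quotalg_pi.
Proof. by split=> // x y; rewrite quotalg_piM. Qed.

HB.instance Definition _ :=
  GRing.isMonoidMorphism.Build F (quotalg S) quotalg_pi quotalg_pi_monoid.

Lemma quotalg_scalerAl (a : K) (x y : quotalg S) : a *: (x * y) = (a *: x) * y.
Proof.
rewrite -[x]quotalg_reprK -[y]quotalg_reprK.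
by rewrite -rmorphM -!linearZ -rmorphM /= scalerAl.
Qed.

Lemma quotalg_scalerAr (a : K) (x y : quotalg S) : a *: (x * y) = x * (a *: y).
Proof.
rewrite -[x]quotalg_reprK -[y]quotalg_reprK.
by rewrite -rmorphM -!linearZ -rmorphM /= scalerAr.
Qed.

Definition is_subalgebra (A : set (quotalg S)) : Prop :=
  [/\ is_subspace A, A 1 & forall x y, A x -> A y -> A (x * y)].

Definition subalg (G : set (quotalg S)) : {pred quotalg S} :=
  fun x => `[< smallest is_subalgebra G x >].

Fact subalg_submod_closed (G : set (quotalg S)) : submod_closed (subalg G).
Proof.
split=> [|a u v /asboolP hu /asboolP hv]; apply/asboolP => A [AS SA].
  by case: AS => -[].
by case: (AS) => -[_ h] _ _; apply: h; [apply: hu | apply: hv].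
Qed.

HB.instance Definition _ (G : set (quotalg S)) :=
  GRing.isSubmodClosed.Build K (quotalg S) (subalg G) (subalg_submod_closed G).

Definition span_mul (A B : {pred quotalg S}) : {pred quotalg S} :=
  span [set x | exists a b, [/\ a \in A, b \in B & x = a * b]].

HB.instance Definition _ (A B : {pred quotalg S}) :=
  GRing.SubmodClosed.on (span_mul A B).
End Ring.
End QuotAlgebra.

(* [{malg K[X]}] is the vector space with basis X. *)
Section LinearExtension.
Context {K : comNzRingType} {X : choiceType} {N : lmodType K}.
Variable f : X -> N.

Definition lin_ext (g : {malg K[X]}) : N := \sum_(x <- msupp g) g@_x *: f x.

Lemma lin_extw (d : {fset X}) (g : {malg K[X]}) :
  (msupp g `<=` d)%fset -> lin_ext g = \sum_(x <- d) g@_x *: f x.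
Proof.
move=> le_d; rewrite /lin_ext (big_fset_incl _ le_d) //= => x _ /mcoeff_outdom ->.
by rewrite scale0r.
Qed.

Fact lin_ext_linear : linear lin_ext.
Proof.
move=> a g h.
pose d := (msupp (a *: g + h) `|` (msupp g `|` msupp h))%fset.
have dg : (msupp g `<=` d)%fset.
  by apply: (fsubset_trans (fsubsetUl _ (msupp h))); apply: fsubsetUr.
have dh : (msupp h `<=` d)%fset.
  by apply: (fsubset_trans (fsubsetUr (msupp g) _)); apply: fsubsetUr.
rewrite (lin_extw dg) (lin_extw dh) (@lin_extw d (a *: g + h)) ?fsubsetUl //.
rewrite scaler_sumr -big_split /=; apply: eq_bigr => x _.
by rewrite mcoeffD mcoeffZ scalerDl scalerA.
Qed.

HB.instance Definition _ :=
  GRing.isLinear.Build K {malg K[X]} N *:%R lin_ext lin_ext_linear.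

Lemma lin_extU x : lin_ext << x >> = f x.
Proof. by rewrite (lin_extw msuppU_le) big_seq_fset1 mcoeffUU scale1r. Qed.
End LinearExtension.

Section Tensor.
Context {K : comNzRingType} (A B : lmodType K).

Inductive tensor_rel : set {malg K[(A * B)%type]} :=
| TensorRelL c (a a' : A) (b : B) : tensor_rel
    (<< (c *: a + a', b) >> - (c *: << (a, b) >> + << (a', b) >>))
| TensorRelR c (a : A) (b b' : B) : tensor_rel
    (<< (a, c *: b + b') >> - (c *: << (a, b) >> + << (a, b') >>)).

Definition tensor : Type := quotmod (span tensor_rel).

HB.instance Definition _ := GRing.Lmodule.on tensor.

Definition pure (a : A) (b : B) : tensor :=
  quot_pi (span tensor_rel) << (a, b) >>.

Section Lift.
Context {N : lmodType K}.

Definition bilinear_map (f : A -> B -> N) : Prop :=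
  (forall b, linear (f^~ b)) /\ (forall a, linear (f a)).

Variable f : A -> B -> N.

Definition tensor_lift (t : tensor) : N :=
  lin_ext (fun p => f p.1 p.2) (@quot_repr _ _ (span tensor_rel) t).

Hypothesis f_bilin : bilinear_map f.

Lemma tensor_lift_pi (g : {malg K[(A * B)%type]}) :
  tensor_lift (quot_pi (span tensor_rel) g) = lin_ext (fun p => f p.1 p.2) g.
Proof.
pose Z : set {malg K[(A * B)%type]} := [set g | lin_ext (fun p => f p.1 p.2) g = 0].
have Zs : is_subspace Z.
  split=> [|c u v]; rewrite /Z /=; first exact: linear0.
  by move=> hu hv; rewrite linearP /= hu hv scaler0 addr0.
have SZ : tensor_rel `<=` Z.
  case: f_bilin => fl fr _ [c a a' b|c a b b']; 
    rewrite /Z /= linearB linearP /= !lin_extU /=.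
    by rewrite fl subrr.
  by rewrite fr subrr.
apply/eqP; rewrite -subr_eq0 -linearB; apply/eqP.
by apply: (span_sub Zs SZ); apply/quot_piP; rewrite quot_reprK.
Qed.

Lemma tensor_lift_pure a b : tensor_lift (pure a b) = f a b.
Proof. by rewrite tensor_lift_pi lin_extU. Qed.

Lemma tensor_lift_linear : linear tensor_lift.
Proof.
move=> c x y.
rewrite -[x](@quot_reprK _ _ (span tensor_rel)).
rewrite -[y](@quot_reprK _ _ (span tensor_rel)).
by rewrite -linearP !tensor_lift_pi linearP.
Qed.
End Lift.
End Tensor.

Section MultiplicationMap.
Context {K : comNzRingType} {F : algType K} {S : set F}.
Variables A B : submodClosed (quotalg S).

Fact mul_bilinear : bilinear_map
  (fun (a : subsp A) (b : subsp B) => \val a * \val b).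
Proof.
split=> [b|a] c x y.
  by rewrite mulrDl quotalg_scalerAl.
by rewrite mulrDr quotalg_scalerAr.
Qed.

(* A (x) B -> F/(S), a (x) b |-> ab *)
Definition mult_map : tensor (subsp A) (subsp B) -> quotalg S :=
  tensor_lift (fun (a : subsp A) (b : subsp B) => \val a * \val b).

HB.instance Definition _ := GRing.isLinear.Build
  K (tensor (subsp A) (subsp B)) (quotalg S) *:%R mult_map
  (tensor_lift_linear mul_bilinear).

Lemma mult_map_pure a b : mult_map (pure a b) = \val a * \val b.
Proof. exact: (tensor_lift_pure mul_bilinear). Qed.
End MultiplicationMap.
Arguments mult_map {K F S} A B _.

(* The free associative algebra on X. monalg provides the full algebra structure
   of {malg K[M]} only for commutative M. *)
Section FreeAlgebra.
Context {K : comNzRingType} {X : choiceType}.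

Definition free_alg : Type := {malg K[{fmonom X}]}.

HB.instance Definition _ := GRing.Lalgebra.on free_alg.

Fact free_alg_scalerAr (k : K) (x y : free_alg) : k *: (x * y) = x * (k *: y).
Proof.
rewrite (monalgE (y : {malg K[{fmonom X}]})).
rewrite mulr_sumr !scaler_sumr mulr_sumr; apply: eq_bigr => m _.
rewrite (monalgE (x : {malg K[{fmonom X}]})).
rewrite !mulr_suml scaler_sumr; apply: eq_bigr => m' _.
apply/malgP => z; rewrite !malgM_def !fgmulUU mcoeffZ.
have -> : k *: << y@_m *g m >> = << k * y@_m *g m >> :> {malg K[{fmonom X}]}.
  by apply/malgP => w; rewrite mcoeffZ !mcoeffU mulrnAr.
by rewrite fgmulUU !mcoeffU mulrnAr mulrCA.
Qed.

HB.instance Definition _ :=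
  GRing.Lalgebra_isAlgebra.Build K free_alg free_alg_scalerAr.

Definition free_gen (x : X) : free_alg := << fmu x >>.
End FreeAlgebra.
Arguments free_alg : clear implicits.

Definition int_binom (K : numFieldType) (m : int) (i : nat) : K :=
  (\prod_(k < i) (m%:~R - k%:R)) / i`!%:R.

(* [vsa_mode u n v] is u_n v, where Y(u,x) = \sum_n u_n x^(-n-1). [vsa_jacobi] is
   the coefficient of x0^(-l-1) x1^(-m-1) x2^(-n-1) in the super Jacobi identity
     x0^-1 delta((x1-x2)/x0) Y(u,x1) Y(v,x2)
       - (-1)^(|u||v|) x0^-1 delta((x2-x1)/(-x0)) Y(v,x2) Y(u,x1)
     = x2^-1 delta((x1-x0)/x2) Y(Y(u,x0)v,x2),
   applied to w. By [vsa_truncation] its three sums have finite support. *)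
Record vertexSuperalgebra (K : numFieldType) := VertexSuperalgebra {
  vsa_space :> lmodType K;
  vsa_homog : bool -> set vsa_space;
  vsa_mode : vsa_space -> int -> vsa_space -> vsa_space;
  vsa_vacuum : vsa_space;
  vsa_homog_subspace : forall b, is_subspace (vsa_homog b);
  vsa_homog_add : forall v, exists v0 v1,
    [/\ vsa_homog false v0, vsa_homog true v1 & v = v0 + v1];
  vsa_homog_direct : forall v, vsa_homog false v -> vsa_homog true v -> v = 0;
  vsa_mode_linearl : forall n v, linear (fun u => vsa_mode u n v);
  vsa_mode_linearr : forall u n, linear (vsa_mode u n);
  vsa_truncation : forall u v, exists N : int,
    forall n : int, N <= n -> vsa_mode u n v = 0;
  vsa_homog_vacuum : vsa_homog false vsa_vacuum;
  vsa_homog_mode : forall b c u v n, vsa_homog b u -> vsa_homog c v ->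
    vsa_homog (b (+) c) (vsa_mode u n v);
  vsa_vacuum_mode : forall n v,
    vsa_mode vsa_vacuum n v = if n == -1 then v else 0;
  vsa_creation : forall v, vsa_mode v (-1) vsa_vacuum = v;
  vsa_creation0 : forall v (n : nat), vsa_mode v n%:Z vsa_vacuum = 0;
  vsa_jacobi : forall (b c : bool) u v w (l m n : int),
    vsa_homog b u -> vsa_homog c v ->
    \sum_(i \in [set: nat]) ((-1) ^+ i * int_binom K l i) *:
        vsa_mode u (m + l - i%:Z) (vsa_mode v (n + i%:Z) w)
    - (-1) ^+ (b && c) *:
      \sum_(i \in [set: nat]) ((-1) ^ l * (-1) ^+ i * int_binom K l i) *:
        vsa_mode v (n + l - i%:Z) (vsa_mode u (m + i%:Z) w)
    = \sum_(i \in [set: nat]) int_binom K m i *: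
        vsa_mode (vsa_mode u (l + i%:Z) v) (m + n - i%:Z) w
}.

Section UTilde.
Context {K : numFieldType} (V : vertexSuperalgebra K).
Local Notation F := (free_alg K (V * int)%type).
Local Notation g u n := (free_gen (u, n) : F).

Definition vsa_D (v : V) : V := vsa_mode v (-2) (vsa_vacuum V).

Inductive U_rel : set F :=
| U_rel_linear a u v n : U_rel (g (a *: u + v) n - (a *: g u n + g v n))
| U_rel_vacuum n : U_rel (g (vsa_vacuum V) n - (n == 0)%:R)
| U_rel_D u n : U_rel (g (vsa_D u) n + n%:~R *: g u n)
| U_rel_comm (b c : bool) u v (m n : int) (N : nat) :
    vsa_homog b u -> vsa_homog c v ->
    (forall j : nat, (N <= j)%N -> vsa_mode u j%:Z v = 0) ->
    U_rel (g u m * g v n - (-1) ^+ (b && c) *: (g v n * g u m)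
           - \sum_(j < N) (m%:~R ^+ j / j`!%:R) *: g (vsa_mode u j%:Z v) (m + n)).

Definition U := quotalg U_rel.

HB.instance Definition _ := GRing.PzRing.on U.
HB.instance Definition _ := GRing.Lmodule.on U.

Definition U_gen (u : V) (n : int) : U := quotalg_pi U_rel (g u n).

(* The exponent + corresponds to the generators of negative index. *)
Definition U_plus : {pred U} :=
  subalg [set x | exists (u : V) (n : nat), (0 < n)%N /\ x = U_gen u (- n%:Z)].
Definition U_minus : {pred U} :=
  subalg [set x | exists (u : V) (n : nat), (0 < n)%N /\ x = U_gen u n%:Z].
Definition U_zero : {pred U} := subalg [set x | exists u : V, x = U_gen u 0].
Definition U_zero_minus : {pred U} := span_mul U_zero U_minus.

HB.instance Definition _ := GRing.SubmodClosed.on U_plus.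
HB.instance Definition _ := GRing.SubmodClosed.on U_minus.
HB.instance Definition _ := GRing.SubmodClosed.on U_zero.
HB.instance Definition _ := GRing.SubmodClosed.on U_zero_minus.
End UTilde.
Arguments U_plus {K} V _.
Arguments U_minus {K} V _.
Arguments U_zero {K} V _.
Arguments U_zero_minus {K} V _.

(* Main.v *)
From HB Require Import structures.
From mathcomp Require Import all_boot all_order all_algebra.
From mathcomp Require Import finmap monalg complex.
From mathcomp Require Import boolp classical_sets functions fsbigop reals.
From mathcomp Require Import zify ring.
Require Import Defs.

Set Implicit Arguments.
Unset Strict Implicit.
Unset Printing Implicit Defensive.

Import Order.TTheory GRing.Theory Num.Theory.
Local Open Scope ring_scope.
Local Open Scope classical_set_scope.

(**
The defining relations say that the generators [u[n]] span a Lie superalgebra [L] with bracket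
[[u[m], v[n]] = (B_m(u,v))[m+n]], where [B_m(u,v)] is the sum over [j >= 0] of
[m^j/j! u_j v], that is, the residue of [e^(mx) Y(u,x)v]; the algebra [U] is the enveloping algebra
of [L], with the central element [1[0]] set equal to [1].  Degree splits [L] into two
subalgebras, [L_+] (negative indices) and [L_-] (indices [>= 0]), and the theorem is the
decomposition [U(L_+ + L_-) = U(L_+) (x) U(L_-)].

The inverse of the multiplication map is built from an induced module.  Given an [L_-]-module [N], the space [U(L_+) (x) N] becomes an
[L]-module by moving an element of [L_-] across a word of letters of [L_+], one letter at a
time, until it reaches [N].  It is easier to describe the dual side, where there is no quotient to
take: a linear map from [U(L_+) (x) N] to a space [E] is a function [f] of a word in [L_+] and a
vector of [N] that satisfies the relations of [U(L_+)] at every place of the word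
([coherent]), and [x] in [L] acts on the right by [(f.x)(w, n) = f(x w, n)] ([act]).  The two
facts to check are that [f.x] is again coherent ([coherent_act]) and that
[f.x.y = +- f.y.x + f.[x,y]] ([act_comm]); both are inductions on the word whose only inputs
are the Jacobi identity ([emode_jacobi]) and skew-symmetry ([emode_skew]) of the bracket, which
come from the Jacobi identity of the vertex superalgebra.  Hence [U] acts on coherent functions
([free_act_ideal]).

Now let [N] be the subalgebra generated by the [u[n]] with [n >= 0], the second factor of the
tensor product, let [E] be the tensor product itself, and let [f_1(w, n) = w (x) n] ([base_fun]).
The map [q |-> (f_1.q)(empty word, 1)] ([splitting]) inverts multiplication.  On the one hand
[f_1.(ab)] at [(empty word, 1)] is [f_1.a] at [(empty word, b)], which is [a (x) b]
([U_act_base_fun], [acts_as_mul_zero_minus]).  On the other hand, composing [f_1] with the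
multiplication gives the function [(w, n) |-> w n] in [U], for which acting by [q] is literally
inserting [q] in front ([realizes_free_act]).
*)

(** * Finite sums and exponential coefficients *)

Section Sums.

Lemma fsbig_natT (E : nmodType) (F : nat -> E) N :
  (forall i, (N <= i)%N -> F i = 0) ->
  \sum_(i \in [set: nat]) F i = \sum_(i < N) F i.
Proof.
move=> F0; rewrite fsbig_ord; apply/esym/fsbig_widen => // i [_ /= /negP].
by rewrite -leqNgt; apply: F0.
Qed.

Lemma fsbig_nat1 (E : nmodType) (F : nat -> E) k :
  (forall i, i != k -> F i = 0) -> \sum_(i \in [set: nat]) F i = F k.
Proof.
move=> F0; rewrite (@fsbig_natT _ _ k.+1) => [|i ki]; last first.
  by apply: F0; rewrite gtn_eqF.
rewrite big_ord_recr big1 /= ?add0r// => i _.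
by apply: F0; rewrite ltn_eqF.
Qed.

Lemma sum_ord_widen (E : nmodType) (F : nat -> E) N M : (N <= M)%N ->
  (forall i, (N <= i)%N -> F i = 0) -> \sum_(i < M) F i = \sum_(i < N) F i.
Proof.
move=> NM F0; rewrite -(fsbig_natT F0) (@fsbig_natT _ _ M)// => i Mi.
by apply: F0; apply: leq_trans Mi.
Qed.

(** The two sides list the same pairs [(i, j)], by their sum and by rows; the vanishing condition
kills the half of the square above the antidiagonal. *)
Lemma sum_triangle (E : nmodType) (G : nat -> nat -> E) M :
  (forall i j, (M <= i + j)%N -> G i j = 0) ->
  \sum_(n < M) \sum_(i < n.+1) G i (n - i)%N = \sum_(i < M) \sum_(j < M) G i j.
Proof.
move=> G0.
transitivity (\sum_(n < M) \sum_(i < M | (i <= n)%N) G i (n - i)%N).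
  apply: eq_bigr => n _; rewrite [LHS](big_ord_widen M (fun i => G i (n - i)%N))//.
rewrite (exchange_big_dep predT)//=; apply: eq_bigr => i _.
rewrite -(big_mkord xpredT) -(big_mkord (fun n => i <= n)%N (fun n => G i (n - i)%N)).
rewrite [RHS](@big_cat_nat _ _ _ (M - i))//= ?leq_subr//.
rewrite [X in _ = _ + X]big_nat_cond [X in _ = _ + X]big1 ?addr0; last first.
  by move=> j /andP[/andP[ij _] _]; apply: G0; rewrite addnC -leq_subLR; lia.
rewrite (@big_cat_nat _ _ _ i)//= ?(ltnW (ltn_ord i))//.
rewrite [X in X + _]big_nat_cond [X in X + _]big1 ?add0r; last first.
  by move=> j /andP[/andP[_ ji]] /=; rewrite leqNgt ji.
rewrite -{1}[nat_of_ord i]add0n big_addn big_nat_cond [RHS]big_nat_cond.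
by apply: eq_big => [j|j _]; rewrite ?leq_addl ?andbT// addnK.
Qed.

End Sums.

Section IntBinom.
Context {K : numFieldType}.

Lemma int_binom0 i : int_binom K 0 i = (i == 0%N)%:R.
Proof.
by case: i => [|i]; rewrite /int_binom ?big_ord0 ?divr1// big_ord_recl subrr mul0r mul0r.
Qed.

Lemma int_binom_nat (m i : nat) : int_binom K m%:Z i = 'C(m, i)%:R.
Proof.
rewrite /int_binom; apply: (canLR (mulfK _)); first by rewrite pnatr_eq0 -lt0n fact_gt0.
rewrite -natrM bin_ffact; elim: i => [|i IH]; first by rewrite big_ord0 ffactn0.
rewrite big_ord_recr /= IH ffactnSr natrM; case: (leqP i m) => im; first by rewrite natrB.
by rewrite ffact_small ?mul0r.
Qed.

Lemma int_binomN1 i : int_binom K (-1) i = (-1) ^+ i.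
Proof.
rewrite /int_binom; apply: (canLR (mulfK _)); first by rewrite pnatr_eq0 -lt0n fact_gt0.
elim: i => [|i IH]; first by rewrite big_ord0 mul1r.
rewrite big_ord_recr /= IH factS natrM exprSr.
have -> : (-1)%:~R - i%:R = - i.+1%:R :> K by rewrite rmorphN -opprD -natrD add1n.
by rewrite mulrN mulrN1 !mulNr -!mulrA [i`!%:R * _]mulrC.
Qed.

Lemma int_binomN2 i : int_binom K (-2) i = (-1) ^+ i * i.+1%:R.
Proof.
rewrite /int_binom; apply: (canLR (mulfK _)); first by rewrite pnatr_eq0 -lt0n fact_gt0.
elim: i => [|i IH]; first by rewrite big_ord0 !mul1r.
rewrite big_ord_recr /= IH factS natrM exprSr.
have -> : (-2)%:~R - i%:R = - i.+2%:R :> K.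
  by rewrite rmorphN -opprD -natrD add2n.
rewrite mulrN mulrN1 !mulNr -!mulrA; congr (- (_ * _)).
by rewrite [RHS]mulrC -!mulrA [i`!%:R * _]mulrC.
Qed.

(** The coefficient of [z^j] in [e^(xz)]. *)
Definition expc (x : K) (j : nat) := x ^+ j / j`!%:R.

Lemma expcD x y p :
  expc (x + y) p = \sum_(i < p.+1) expc x i * expc y (p - i).
Proof.
rewrite /expc exprDn mulr_suml (reindex_inj rev_ord_inj) /=; apply: eq_bigr => i _.
have ip : (i <= p)%N by rewrite -ltnS.
rewrite subSS subKn// bin_sub// -mulr_natr -(bin_fact ip).
have f0 (k : nat) : k`!%:R != 0 :> K by rewrite pnatr_eq0 -lt0n fact_gt0.
have b0 : 'C(p, i)%:R != 0 :> K by rewrite pnatr_eq0 -lt0n bin_gt0.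
by rewrite !natrM; field; rewrite !f0 b0.
Qed.

Lemma expc_bin x (i k : nat) : (k <= i)%N ->
  expc x i * 'C(i, k)%:R = expc x k * expc x (i - k).
Proof.
move=> ki; rewrite /expc -{1}(subnKC ki) exprD -(bin_fact ki).
have f0 (n : nat) : n`!%:R != 0 :> K by rewrite pnatr_eq0 -lt0n fact_gt0.
have b0 : 'C(i, k)%:R != 0 :> K by rewrite pnatr_eq0 -lt0n bin_gt0.
by rewrite !natrM; field; rewrite !f0 b0.
Qed.

(** [e^(xS) e^(yS) = e^((x+y)S)] for the shift [S] acting on a finite sequence [T].  This is the
only way in which exponentials enter, both in the Jacobi identity and in skew-symmetry. *)
Lemma sum_expcD (E : lmodType K) (T : nat -> E) x y N M : (N <= M)%N ->
  (forall p, (N <= p)%N -> T p = 0) ->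
  \sum_(i < M) \sum_(j < M) (expc x i * expc y j) *: T (i + j)%N =
  \sum_(p < M) expc (x + y) p *: T p.
Proof.
move=> NM T0.
rewrite -(@sum_triangle _ (fun i j => (expc x i * expc y j) *: T (i + j)%N)).
  apply: eq_bigr => n _; rewrite expcD scaler_suml; apply: eq_bigr => i _.
  by rewrite subnKC// -ltnS.
by move=> i j Mij; rewrite T0 ?scaler0// (leq_trans NM).
Qed.

End IntBinom.

(** * The exponential modes of a vertex superalgebra *)

Section Modes.
Context {K : numFieldType} (V : vertexSuperalgebra K).
Implicit Types (b c d : bool) (u v w : V) (m n : int).

Local Notation "1v" := (vsa_vacuum V).

HB.instance Definition _ u n :=
  GRing.isLinear.Build K V V *:%R (vsa_mode u n) (vsa_mode_linearr u n).

(** The arguments are swapped so that the map that is linear is the last one. *)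
Definition mode_left n v u := vsa_mode u n v.
HB.instance Definition _ n v :=
  GRing.isLinear.Build K V V *:%R (mode_left n v) (vsa_mode_linearl n v).

Lemma vsa_mode0l n v : vsa_mode 0 n v = 0.
Proof. exact: (linear0 (mode_left n v)). Qed.

Lemma vsa_vacuum0 n v : n <> -1 -> vsa_mode 1v n v = 0.
Proof. by rewrite vsa_vacuum_mode; case: eqP. Qed.

Lemma vsa_vacuum1 n v : n = -1 -> vsa_mode 1v n v = v.
Proof. by rewrite vsa_vacuum_mode; case: eqP. Qed.

Lemma vsa_trunc u v : exists N : nat, forall j : nat, (N <= j)%N -> vsa_mode u j%:Z v = 0.
Proof.
have [N hN] := vsa_truncation u v; exists `|N|%N => j Nj; apply: hN; lia.
Qed.

(** The Jacobi identity at [l = 0], where each sum on the left has a single term. *)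
Lemma vsa_mode_comm b c u v w m n N : vsa_homog b u -> vsa_homog c v ->
  (forall j : nat, (N <= j)%N -> vsa_mode u j%:Z v = 0) ->
  vsa_mode u m (vsa_mode v n w) - (-1) ^+ (b && c) *: vsa_mode v n (vsa_mode u m w) =
  \sum_(i < N) int_binom K m i *: vsa_mode (vsa_mode u i%:Z v) (m + n - i%:Z) w.
Proof.
move=> hu hv uN; have := @vsa_jacobi K V b c u v w 0 m n hu hv.
rewrite (@fsbig_nat1 _ _ 0%N) => [|i i0]; last by rewrite int_binom0 (negPf i0) mulr0 scale0r.
rewrite (@fsbig_nat1 _ _ 0%N) => [|i i0]; last by rewrite int_binom0 (negPf i0) mulr0 scale0r.
rewrite (@fsbig_natT _ _ N) => [|i Ni]; last first.
  by rewrite add0r uN// vsa_mode0l scaler0.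
rewrite int_binom0 expr0 expr0z !mulr1 !scale1r !addr0.
by move=> ->; apply: eq_bigr => i _; rewrite add0r.
Qed.

Lemma vsa_D_linear : linear (@vsa_D K V).
Proof. by move=> a u v; rewrite /vsa_D vsa_mode_linearl. Qed.
HB.instance Definition _ := GRing.isLinear.Build K V V *:%R (@vsa_D K V) vsa_D_linear.

Lemma vsa_homog_D b u : vsa_homog b u -> vsa_homog b (vsa_D u).
Proof. by move=> hu; rewrite -[b]addbF; apply: vsa_homog_mode (vsa_homog_vacuum V). Qed.

(** The Jacobi identity at [v = 1], [l = -2], [m = 0]: the right-hand side has the single term
[(u_(-2) 1)_n w]. *)
Lemma vsa_D_mode_gen b u w n : vsa_homog b u ->
  vsa_mode (vsa_D u) n w =
  \sum_(i \in [set: nat]) ((-1) ^+ i * int_binom K (-2) i) *: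
     vsa_mode u (- 2 - i%:Z) (vsa_mode 1v (n + i%:Z) w)
  - \sum_(i \in [set: nat]) ((-1) ^+ i * int_binom K (-2) i) *:
     vsa_mode 1v (n - 2 - i%:Z) (vsa_mode u i%:Z w).
Proof.
move=> hu; have := @vsa_jacobi K V b false u 1v w (-2) 0 n hu (vsa_homog_vacuum V).
rewrite [X in _ = X -> _](@fsbig_nat1 _ _ 0%N) => [|i i0]; last first.
  by rewrite int_binom0 (negPf i0) scale0r.
rewrite int_binom0 scale1r !(add0r, addr0) => <-.
rewrite andbF expr0 scale1r; congr (_ - _); apply: eq_fsbigr => i _.
by rewrite -exprnN /= expr2 mulN1r opprK invr1 mul1r add0r.
Qed.

Lemma vsa_D_mode_nat b u w (j : nat) : vsa_homog b u ->
  vsa_mode (vsa_D u) j%:Z w = - (j%:R *: vsa_mode u (j%:Z - 1) w).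
Proof.
move=> hu; rewrite (vsa_D_mode_gen _ _ hu) fsbig1 ?sub0r => [|i _]; last first.
  by rewrite vsa_vacuum0 ?linear0 ?scaler0//; lia.
congr (- _); case: j => [|j].
  rewrite scale0r fsbig1// => i _.
  by rewrite vsa_vacuum0 ?scaler0//; lia.
rewrite (@fsbig_nat1 _ _ j) => [|i /eqP ij]; last first.
  by rewrite vsa_vacuum0 ?scaler0//; lia.
rewrite vsa_vacuum1; last by lia.
rewrite int_binomN2 signrMK; congr (_ *: vsa_mode _ _ _); lia.
Qed.

(** Iterated, this identifies [u_(-i-1) 1] with [D^i u / i!]. *)
Lemma vsa_D_mode_neg b u (i : nat) : vsa_homog b u ->
  vsa_mode (vsa_D u) (- i.+1%:Z) 1v = i.+1%:R *: vsa_mode u (- i.+2%:Z) 1v.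
Proof.
move=> hu; rewrite (vsa_D_mode_gen _ _ hu).
rewrite [X in _ - X]fsbig1 ?subr0 => [|k _]; last by rewrite vsa_creation0 linear0 scaler0.
rewrite (@fsbig_nat1 _ _ i) => [|k /eqP ki]; last first.
  by rewrite vsa_vacuum0 ?linear0 ?scaler0//; lia.
rewrite vsa_vacuum1; last by lia.
rewrite int_binomN2 signrMK; congr (_ *: vsa_mode _ _ _); lia.
Qed.

(** [D v = v_(-2) 1] and [u_j 1 = 0], so the commutator of [u_j] with [v_(-2)], applied to the
vacuum, computes [u_j D v]. *)
Lemma vsa_mode_D b c u v (j : nat) : vsa_homog b u -> vsa_homog c v ->
  vsa_mode u j%:Z (vsa_D v) =
  vsa_D (vsa_mode u j%:Z v) + j%:R *: vsa_mode u (j%:Z - 1) v.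
Proof.
move=> hu hv; have [N0 hN0] := vsa_trunc u v.
pose N := maxn j.+1 N0.
have hN k : (N <= k)%N -> vsa_mode u k%:Z v = 0.
  by move=> Nk; apply: hN0; apply: leq_trans Nk; apply: leq_maxr.
have := vsa_mode_comm 1v j%:Z (-2) hu hv hN.
rewrite vsa_creation0 linear0 scaler0 subr0 => ->.
have E (k : nat) : (k.+1 < j)%N || (j < k)%N ->
    int_binom K j k *: vsa_mode (vsa_mode u k v) (j%:Z - 2 - k%:Z) 1v = 0.
  move=> /orP[kj|jk]; last by rewrite int_binom_nat bin_small ?scale0r.
  have -> : j%:Z - 2 - k%:Z = (j - 2 - k)%N by lia.
  by rewrite vsa_creation0 scaler0.
rewrite (@sum_ord_widen _ (fun k => int_binom K j k *:
   vsa_mode (vsa_mode u k v) (j%:Z - 2 - k%:Z) 1v) j.+1) ?leq_maxl//; last first.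
  by move=> k jk; apply: E; rewrite jk orbT.
rewrite big_ord_recr /= int_binom_nat binn scale1r addrC; congr (_ + _).
  by rewrite /vsa_D; congr (vsa_mode _ _ _); lia.
case: j N hN E => [|j] N hN E; first by rewrite big_ord0 scale0r.
rewrite big_ord_recr /= big1 ?add0r => [|i _]; last by apply: E; rewrite ltnS ltn_ord.
rewrite int_binom_nat binSn.
have -> : j.+1%:Z - 2 - j%:Z = -1 by lia.
by rewrite vsa_creation; congr (_ *: vsa_mode _ _ _); lia.
Qed.

(** The Jacobi identity at [m = -1], [n = 0], applied to the vacuum: the first sum vanishes by
creation and the second keeps only the term [v_l u_(-1) 1 = v_l u]. *)
Lemma vsa_mode_skew b c u v (l : nat) N : vsa_homog b u -> vsa_homog c v ->
  (forall j : nat, (N <= j)%N -> vsa_mode u j%:Z v = 0) ->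
  vsa_mode v l%:Z u = - ((-1) ^+ (b && c) *: \sum_(i < N)
    (-1) ^+ (l + i) *: vsa_mode (vsa_mode u (l + i)%:Z v) (- i.+1%:Z) 1v).
Proof.
move=> hu hv uN; have := @vsa_jacobi K V b c u v 1v l%:Z (-1) 0 hu hv.
rewrite fsbig1 => [|i _]; last by rewrite add0r vsa_creation0 linear0 scaler0.
rewrite (@fsbig_nat1 _ _ 0%N) => [|[|i] // _]; last first.
  have -> : -1 + i.+1%:Z = i by lia.
  by rewrite vsa_creation0 linear0 scaler0.
rewrite (@fsbig_natT _ _ N) => [|i Ni]; last first.
  by rewrite uN ?vsa_mode0l ?scaler0// (leq_trans Ni)// leq_addl.
rewrite addr0 vsa_creation subr0 sub0r int_binom_nat bin0 !mulr1 add0r => E.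
have -> : \sum_(i < N) (-1) ^+ (l + i) *:
     vsa_mode (vsa_mode u (l + i)%N v) (- i.+1%:Z) 1v =
   (-1) ^+ l *: - ((-1) ^+ (b && c) *: ((-1) ^ l *: vsa_mode v l u)).
    rewrite E scaler_sumr; apply: eq_bigr => i _; rewrite scalerA int_binomN1 -exprD.
  congr (_ *: vsa_mode _ _ _); lia.
rewrite !scalerN opprK -!exprnP !scalerA -(mulrA (_ * _)) -expr2 exprMn.
by rewrite !sqrr_sign mulr1 scale1r.
Qed.

(** Some bound for truncation; [emodeE] shows that the value of [emode] is the same for all. *)
Definition vsa_bound u v : nat := projT1 (cid (vsa_trunc u v)).

Lemma vsa_boundP u v (j : nat) : (vsa_bound u v <= j)%N -> vsa_mode u j%:Z v = 0.
Proof. by rewrite /vsa_bound; case: cid => N /= hN; apply: hN. Qed.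

(** [B_m(u,v)], the residue of [e^(mx) Y(u,x)v]: the relations of [U] make [u[m]] and [v[n]]
supercommute up to [(B_m(u,v))[m+n]]. *)
Definition emode m u v : V :=
  \sum_(j < vsa_bound u v) expc m%:~R j *: vsa_mode u j%:Z v.

Lemma emodeE m u v N : (forall j : nat, (N <= j)%N -> vsa_mode u j%:Z v = 0) ->
  emode m u v = \sum_(j < N) expc m%:~R j *: vsa_mode u j%:Z v.
Proof.
move=> uN; pose F (j : nat) := expc m%:~R j *: vsa_mode u j%:Z v.
have FN j : (N <= j)%N -> F j = 0 by move=> Nj; rewrite /F uN ?scaler0.
have FB j : (vsa_bound u v <= j)%N -> F j = 0.
  by move=> Nj; rewrite /F vsa_boundP ?scaler0.
by rewrite -[RHS](fsbig_natT FN) (fsbig_natT FB).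
Qed.

Lemma emode_linearr m u : linear (emode m u).
Proof.
move=> a v w; pose N := maxn (vsa_bound u v) (vsa_bound u w).
have hv (j : nat) : (N <= j)%N -> vsa_mode u j v = 0.
  by move=> Nj; rewrite vsa_boundP// (leq_trans _ Nj)// leq_maxl.
have hw (j : nat) : (N <= j)%N -> vsa_mode u j w = 0.
  by move=> Nj; rewrite vsa_boundP// (leq_trans _ Nj)// leq_maxr.
rewrite !(@emodeE _ _ _ N)// => [|j Nj]; last by rewrite linearP /= hv ?hw ?scaler0 ?addr0.
rewrite scaler_sumr -big_split; apply: eq_bigr => j _ /=.
by rewrite linearP /= scalerDr !scalerA mulrC.
Qed.

Lemma emode_linearl m v : linear (fun u => emode m u v).
Proof.
move=> a u w; pose N := maxn (vsa_bound u v) (vsa_bound w v).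
have hv (j : nat) : (N <= j)%N -> vsa_mode u j v = 0.
  by move=> Nj; rewrite vsa_boundP// (leq_trans _ Nj)// leq_maxl.
have hw (j : nat) : (N <= j)%N -> vsa_mode w j v = 0.
  by move=> Nj; rewrite vsa_boundP// (leq_trans _ Nj)// leq_maxr.
rewrite !(@emodeE _ _ _ N)// => [|j Nj]; last first.
  by rewrite vsa_mode_linearl hv ?hw ?scaler0 ?addr0.
rewrite scaler_sumr -big_split; apply: eq_bigr => j _ /=.
by rewrite vsa_mode_linearl scalerDr !scalerA mulrC.
Qed.

HB.instance Definition _ m u :=
  GRing.isLinear.Build K V V *:%R (emode m u) (emode_linearr m u).
(** Swapped for the same reason as [mode_left]. *)
Definition emode_left m v u := emode m u v.
HB.instance Definition _ m v :=
  GRing.isLinear.Build K V V *:%R (emode_left m v) (emode_linearl m v).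

Lemma vsa_homog_sum b (I : Type) (r : seq I) (P : pred I) (F : I -> V) :
  (forall i, P i -> vsa_homog b (F i)) -> vsa_homog b (\sum_(i <- r | P i) F i).
Proof.
have [h0 hD] := @vsa_homog_subspace K V b.
move=> hF; elim/big_rec: _ => // i x Pi hx.
by rewrite -[F i]scale1r; apply: hD => //; apply: hF.
Qed.

Lemma vsa_homogZ b a u : vsa_homog b u -> vsa_homog b (a *: u).
Proof.
by have [h0 hD] := @vsa_homog_subspace K V b => hu; rewrite -[_ *: _]addr0; apply: hD.
Qed.

Lemma vsa_homog_emode b c m u v : vsa_homog b u -> vsa_homog c v ->
  vsa_homog (b (+) c) (emode m u v).
Proof.
by move=> hu hv; apply: vsa_homog_sum => i _; apply: vsa_homogZ; apply: vsa_homog_mode.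
Qed.

Lemma emode_vacuum m v : emode m 1v v = 0.
Proof.
rewrite (@emodeE _ _ _ 0%N) ?big_ord0// => j _.
by rewrite vsa_vacuum_mode.
Qed.

Lemma expcS (x : K) j : expc x j.+1 * j.+1%:R = x * expc x j.
Proof.
have : j.+1%:R != 0 :> K by rewrite pnatr_eq0.
have : j`!%:R != 0 :> K by rewrite pnatr_eq0 -lt0n fact_gt0.
rewrite /expc factS natrM exprS; move: (j.+1%:R) (j`!%:R) => p q q0 p0.
by field; rewrite p0 q0.
Qed.

(** [d/dz e^(mz) = m e^(mz)], in the form in which [D] meets [emode]. *)
Lemma emode_shift m u v N : (forall j : nat, (N <= j)%N -> vsa_mode u j%:Z v = 0) ->
  \sum_(j < N.+1) (expc m%:~R j * j%:R) *: vsa_mode u (j%:Z - 1) v = m%:~R *: emode m u v.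
Proof.
move=> uN; rewrite big_ord_recl mulr0 scale0r add0r (emodeE _ uN) scaler_sumr.
apply: eq_bigr => j _; rewrite lift0 expcS scalerA; congr (_ *: vsa_mode _ _ _); lia.
Qed.

Lemma emode_Dl b m u v : vsa_homog b u -> emode m (vsa_D u) v = - (m%:~R *: emode m u v).
Proof.
move=> hu; pose N := vsa_bound u v.
have hN (j : nat) : (N <= j)%N -> vsa_mode u j v = 0 by apply: vsa_boundP.
rewrite (@emodeE _ _ _ N.+1) => [|[//|j] Nj]; last first.
  rewrite (vsa_D_mode_nat _ _ hu); have -> : j.+1%:Z - 1 = j by lia.
  by rewrite hN ?scaler0 ?oppr0.
rewrite -(emode_shift _ hN) -sumrN; apply: eq_bigr => j _.
by rewrite (vsa_D_mode_nat _ _ hu) scalerN scalerA.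
Qed.

Lemma emode_Dr b c m u v : vsa_homog b u -> vsa_homog c v ->
  emode m u (vsa_D v) = vsa_D (emode m u v) + m%:~R *: emode m u v.
Proof.
move=> hu hv; pose N := vsa_bound u v.
have hN (j : nat) : (N <= j)%N -> vsa_mode u j v = 0 by apply: vsa_boundP.
have hN1 (j : nat) : (N.+1 <= j)%N -> vsa_mode u j v = 0 by move=> /ltnW; apply: hN.
rewrite (@emodeE _ _ _ N.+1) => [|[//|j] Nj]; last first.
  rewrite (vsa_mode_D _ hu hv) hN1// linear0 add0r; have -> : j.+1%:Z - 1 = j by lia.
  by rewrite hN ?scaler0.
rewrite -(emode_shift _ hN) (emodeE _ hN1) linear_sum -big_split; apply: eq_bigr => j _ /=.
by rewrite (vsa_mode_D _ hu hv) scalerDr scalerA linearZ.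
Qed.

(** [u_(-i-1) 1] is [D^i u / i!], and [psi] turns [D] into multiplication by [-k]. *)
Lemma vsa_mode_vac_eval (E : lmodType K) (psi : {linear V -> E}) (k : K) b u (i : nat) :
  (forall w, psi (vsa_D w) = - (k *: psi w)) -> vsa_homog b u ->
  psi (vsa_mode u (- i.+1%:Z) 1v) = expc (- k) i *: psi u.
Proof.
move=> psiD; elim: i u => [|i IH] u hu.
  by rewrite vsa_creation /expc expr0 divr1 scale1r.
have i0 : i.+1%:R != 0 :> K by rewrite pnatr_eq0.
apply: (scalerI i0); rewrite -linearZ -(vsa_D_mode_neg _ hu) IH; last exact: vsa_homog_D.
rewrite psiD -scaleNr !scalerA; congr (_ *: _).
by rewrite [RHS]mulrC expcS mulrC.
Qed.

(** Skew-symmetry of the bracket fails in [V] and holds only modulo [D + (m+n)]; a functional [psi]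
that vanishes there is therefore part of the statement.  Substituting [vsa_mode_skew], the sum
becomes [e^(nz) e^(-(m+n)z) = e^(-mz)]. *)
Lemma emode_skew (E : lmodType K) (psi : {linear V -> E}) b c u v m n :
  (forall w, psi (vsa_D w) = - ((m + n)%:~R *: psi w)) ->
  vsa_homog b u -> vsa_homog c v ->
  psi (emode n v u) = - ((-1) ^+ (b && c) *: psi (emode m u v)).
Proof.
move=> psiD hu hv; pose N := maxn (vsa_bound u v) (vsa_bound v u).
have hN (j : nat) : (N <= j)%N -> vsa_mode u j v = 0.
  by move=> Nj; rewrite vsa_boundP// (leq_trans _ Nj)// leq_maxl.
have hN' (j : nat) : (N <= j)%N -> vsa_mode v j u = 0.
  by move=> Nj; rewrite vsa_boundP// (leq_trans _ Nj)// leq_maxr.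
rewrite (emodeE _ hN) (emodeE _ hN') !(linear_sum psi) /=.
pose T p := (-1) ^+ p *: psi (vsa_mode u p%:Z v).
have TN p : (N <= p)%N -> T p = 0 by move=> Np; rewrite /T hN// linear0 scaler0.
have expcN (x : K) p : expc (- x) p = (-1) ^+ p * expc x p.
  by rewrite /expc [in LHS]exprNn mulrA.
transitivity (- ((-1) ^+ (b && c) *: \sum_(i < N) \sum_(j < N)
    (expc n%:~R i * expc (- (m + n)%:~R) j) *: T (i + j)%N) : E).
  rewrite scaler_sumr -sumrN; apply: eq_bigr => l _.
  rewrite (vsa_mode_skew _ hu hv hN) linearZ linearN linearZ /= scalerN; congr (- _).
  rewrite scalerA mulrC -scalerA; congr (_ *: _).
  rewrite linear_sum scaler_sumr; apply: eq_bigr => i _.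
  rewrite linearZ /= (@vsa_mode_vac_eval _ psi _ (b (+) c) _ _ psiD); last exact: vsa_homog_mode.
  by rewrite /T !scalerA; congr (_ *: _); ring.
rewrite (sum_expcD _ _ (leqnn N) TN); congr (- _); apply: (congr1 (fun x => _ *: x)).
apply: eq_bigr => p _; rewrite /T scalerA [RHS]linearZ /=; congr (_ *: _).
have -> : n%:~R - (m + n)%:~R = - m%:~R :> K by rewrite intrD; ring.
by rewrite expcN mulrC signrMK.
Qed.

(** An identity in [V] itself, unlike skew-symmetry.  Expand the commutators
[[u_i, v_j]] by [vsa_mode_comm]; since [m^i/i! C(i,k) = m^k/k! m^(i-k)/(i-k)!], the sum over [i] and
[k] separates, and [sum_expcD] collects [e^(mz) e^(nz)]. *)
Lemma emode_jacobi b c u v w m n : vsa_homog b u -> vsa_homog c v ->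
  emode m u (emode n v w) - (-1) ^+ (b && c) *: emode n v (emode m u w) =
  emode (m + n) (emode m u v) w.
Proof.
move=> hu hv.
(* One bound [N] for all modes that occur lets every sum run over the same square of side [2N]. *)
have [N [[huv hvw huw h1 h2] h3]] : exists N : nat, [/\
   forall j : nat, (N <= j)%N -> vsa_mode u j v = 0,
   forall j : nat, (N <= j)%N -> vsa_mode v j w = 0,
   forall j : nat, (N <= j)%N -> vsa_mode u j w = 0,
   forall i j : nat, (N <= j)%N -> vsa_mode u j (vsa_mode v i w) = 0 &
   forall i j : nat, (N <= j)%N -> vsa_mode v j (vsa_mode u i w) = 0] /\
   forall i j : nat, (N <= j)%N -> vsa_mode (vsa_mode u i v) j w = 0.
  have bd (P : nat -> nat -> Prop) : (exists N0, forall i j, (N0 <= i)%N -> P i j) ->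
      (forall i, exists N1, forall j, (N1 <= j)%N -> P i j) ->
      exists N, forall i j, (N <= j)%N -> P i j.
    move=> [N0 h0] /choice[f hf]; exists (\max_(i < N0) f i) => i j Nj.
    case: (leqP N0 i) => [|iN0]; first exact: h0.
    by apply: hf; apply: leq_trans Nj; apply: (leq_bigmax (Ordinal iN0)).
  have [N1 hN1] := vsa_trunc u v.
  have [N2 hN2] := vsa_trunc v w.
  have [N3 hN3] := vsa_trunc u w.
  have [||N4 hN4] := bd (fun i j => vsa_mode u j%:Z (vsa_mode v i%:Z w) = 0).
  - by exists N2 => i j /hN2 ->; rewrite linear0.
  - by move=> i; apply: vsa_trunc.
  have [||N5 hN5] := bd (fun i j => vsa_mode v j%:Z (vsa_mode u i%:Z w) = 0).
  - by exists N3 => i j /hN3 ->; rewrite linear0.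
  - by move=> i; apply: vsa_trunc.
  have [||N6 hN6] := bd (fun i j => vsa_mode (vsa_mode u i%:Z v) j%:Z w = 0).
  - by exists N1 => i j /hN1 ->; rewrite vsa_mode0l.
  - by move=> i; apply: vsa_trunc.
  exists (N1 + N2 + N3 + N4 + N5 + N6)%N.
  by split; first split; move=> *; (apply: hN1 || apply: hN2 || apply: hN3 ||
    apply: hN4 || apply: hN5 || apply: hN6); lia.
pose M := (N + N)%N; have NM : (N <= M)%N by apply: leq_addr.
have up (P : nat -> Prop) : (forall j, (N <= j)%N -> P j) -> forall j, (M <= j)%N -> P j.
  by move=> h j Mj; apply: h; apply: leq_trans Mj.
pose e (x : int) i : K := expc x%:~R i.
have -> : emode m u (emode n v w) =
    \sum_(i < M) \sum_(j < M) (e m i * e n j) *: vsa_mode u i (vsa_mode v j w).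
  rewrite (emodeE _ (up _ hvw)) (@emodeE _ _ _ M) => [|j Mj]; last first.
    rewrite linear_sum big1 // => i _.
    by rewrite linearZ /= h1 ?scaler0// (leq_trans NM).
  apply: eq_bigr => i _; rewrite linear_sum scaler_sumr; apply: eq_bigr => j _.
  by rewrite linearZ scalerA.
have -> : emode n v (emode m u w) =
    \sum_(i < M) \sum_(j < M) (e m i * e n j) *: vsa_mode v j (vsa_mode u i w).
  rewrite (emodeE _ (up _ huw)) (@emodeE _ _ _ M) => [|j Mj]; last first.
    rewrite linear_sum big1 // => i _.
    by rewrite linearZ /= h2 ?scaler0// (leq_trans NM).
  rewrite exchange_big; apply: eq_bigr => i _; rewrite linear_sum scaler_sumr.
  by apply: eq_bigr => j _; rewrite linearZ scalerA mulrC.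
pose T k p := vsa_mode (vsa_mode u k%:Z v) p%:Z w.
pose G k l := \sum_(j < M) (e m k * e m l * e n j) *: T k (l + j)%N.
transitivity (\sum_(i < M) \sum_(k < i.+1) G k (i - k)%N).
  rewrite scaler_sumr -sumrB; apply: eq_bigr => i _.
  rewrite scaler_sumr -sumrB exchange_big; apply: eq_bigr => j _.
  rewrite scalerA [_ ^+ _ * _]mulrC -[X in _ - X]scalerA -scalerBr (vsa_mode_comm _ _ _ hu hv
    (up _ huv)).
  pose F (k : nat) := int_binom K i k *: vsa_mode (vsa_mode u k v) (i%:Z + j%:Z - k%:Z) w.
  rewrite (@sum_ord_widen _ F i.+1)// => [|k ik]; last first.
    by rewrite /F int_binom_nat bin_small ?scale0r.
  rewrite scaler_sumr; apply: eq_bigr => k _.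
  have ki : (k <= i)%N by rewrite -ltnS.
  rewrite /F int_binom_nat scalerA mulrAC expc_bin//; congr (_ *: vsa_mode _ _ _); lia.
rewrite sum_triangle => [|k l Mkl]; last first.
  apply: big1 => j _; rewrite /T; case: (leqP N k) => [Nk|kN].
    by rewrite huv// vsa_mode0l scaler0.
  by rewrite h3 ?scaler0//; rewrite /M in Mkl; lia.
rewrite (emodeE m (up _ huv)) -[RHS]/(emode_left (m + n) w _) linear_sum.
apply: eq_bigr => k _; rewrite linearZ /= /emode_left (emodeE _ (up _ (h3 k))).
rewrite intrD -(sum_expcD _ _ NM (h3 k)) scaler_sumr; apply: eq_bigr => l _.
by rewrite scaler_sumr; apply: eq_bigr => j _; rewrite scalerA [in RHS]mulrA.
Qed.

End Modes.

(** * Deciding linear identities in a module *)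

Section LinearExpressions.
Context {K : comNzRingType} {E : lmodType K}.

(** Linear combinations of the entries of an environment.  An identity between two of them follows
from the equality of their coefficients, which are elements of a commutative ring and so within the
reach of [ring]. *)
Inductive lexp :=
| LVar of nat | LZero | LAdd of lexp & lexp | LOpp of lexp | LScale of K & lexp.

Fixpoint leval (env : seq E) (e : lexp) : E :=
  match e with
  | LVar i => env`_i
  | LZero => 0
  | LAdd e1 e2 => leval env e1 + leval env e2
  | LOpp e1 => - leval env e1
  | LScale a e1 => a *: leval env e1
  end.

Fixpoint lcoef (e : lexp) (i : nat) : K :=
  match e with
  | LVar j => if i == j then 1 else 0
  | LZero => 0
  | LAdd e1 e2 => lcoef e1 i + lcoef e2 i
  | LOpp e1 => - lcoef e1 i
  | LScale a e1 => a * lcoef e1 i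
  end.

Lemma leval_coef env e :
  leval env e = \sum_(i < size env) lcoef e i *: env`_i.
Proof.
elim: e => [j||e1 IH1 e2 IH2|e1 IH1|a e1 IH1] /=.
- case: (ltnP j (size env)) => jn; last first.
    rewrite nth_default// big1 // => i _.
    by rewrite ifF ?scale0r//; apply/negbTE; rewrite neq_ltn (leq_trans (ltn_ord i)).
  rewrite (bigD1 (Ordinal jn)) //= eqxx scale1r big1 ?addr0 // => i /negPf ij.
  by rewrite -[_ == j]/(i == Ordinal jn) ij scale0r.
- by rewrite big1 // => i _; rewrite scale0r.
- by rewrite IH1 IH2 -big_split; apply: eq_bigr => i _; rewrite scalerDl.
- by rewrite IH1 -sumrN; apply: eq_bigr => i _; rewrite scaleNr.
- by rewrite IH1 scaler_sumr; apply: eq_bigr => i _; rewrite scalerA.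
Qed.

Fixpoint lcoefs_eq (n : nat) (e1 e2 : lexp) : Prop :=
  if n is n'.+1 then lcoef e1 n' = lcoef e2 n' /\ lcoefs_eq n' e1 e2 else True.

Lemma leval_eq env e1 e2 :
  lcoefs_eq (size env) e1 e2 -> leval env e1 = leval env e2.
Proof.
move=> h; rewrite !leval_coef; elim: (size env) h => [|n IH] /=.
  by rewrite !big_ord0.
by case=> en /IH h; rewrite !big_ord_recr /= h en.
Qed.

End LinearExpressions.

Ltac lin_index x l :=
  lazymatch l with
  | x :: _ => constr:(0%N)
  | _ :: ?l' => let n := lin_index x l' in constr:(S n)
  end.

Ltac lin_atoms l t :=
  lazymatch t with
  | @GRing.add _ ?a ?b => let l1 := lin_atoms l a in lin_atoms l1 b
  | @GRing.opp _ ?a => lin_atoms l a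
  | @GRing.scale _ _ _ ?a => lin_atoms l a
  | @GRing.zero _ => l
  | _ => lazymatch l with
         | context [t :: _] => l
         | _ => constr:(t :: l)
         end
  end.

Ltac lin_reify l t :=
  lazymatch t with
  | @GRing.add _ ?a ?b =>
      let ea := lin_reify l a in let eb := lin_reify l b in open_constr:(LAdd ea eb)
  | @GRing.opp _ ?a => let ea := lin_reify l a in open_constr:(LOpp ea)
  | @GRing.scale _ _ ?k ?a => let ea := lin_reify l a in open_constr:(LScale k ea)
  | @GRing.zero _ => open_constr:(LZero)
  | _ => let n := lin_index t l in open_constr:(LVar n)
  end.

Ltac lmod_eq :=
  lazymatch goal with
  | |- @eq ?T ?x ?y =>
      let l0 := constr:(@nil T) in
      let l1 := lin_atoms l0 x in let l := lin_atoms l1 y in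
      let ex := lin_reify l x in let ey := lin_reify l y in
      apply: (@leval_eq _ _ l ex ey);
      rewrite /=; repeat (split; first by ring); exact: I
  end.

(** * The bracket on homogeneous letters *)

Section Letters.
Context {K : numFieldType} (V : vertexSuperalgebra K).
Implicit Types (b c d : bool) (u v w : V) (m n : int).

Lemma homog_part_ex v : {p : V * V | [/\ vsa_homog false p.1, vsa_homog true p.2 & v = p.1 + p.2]}.
Proof.
by apply: cid; have [v0 [v1 h]] := @vsa_homog_add K V v; exists (v0, v1).
Qed.

(** Taking homogeneous parts makes every formula with a sign total: no homogeneity condition has to
be carried along with the vectors. *)
Definition homog_part b v : V := if b then (projT1 (homog_part_ex v)).2 else (projT1
  (homog_part_ex v)).1.

Lemma homog_part_homog b v : vsa_homog b (homog_part b v).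
Proof. by rewrite /homog_part; case: homog_part_ex => p /= []; case: b. Qed.

Lemma homog_part_sum v : homog_part false v + homog_part true v = v.
Proof. by rewrite /homog_part; case: homog_part_ex => p /= []. Qed.

Lemma homogD b u v : vsa_homog b u -> vsa_homog b v -> vsa_homog b (u + v).
Proof.
have [h0 hD] := @vsa_homog_subspace K V b => hu hv.
by rewrite -[u]scale1r; apply: hD.
Qed.

Lemma homogB b u v : vsa_homog b u -> vsa_homog b v -> vsa_homog b (u - v).
Proof. by move=> hu hv; apply: homogD => //; rewrite -scaleN1r; apply: vsa_homogZ. Qed.

Lemma homog_part_uniq u v : vsa_homog false u -> vsa_homog true v ->
  homog_part false (u + v) = u /\ homog_part true (u + v) = v.
Proof.
move=> hu hv; set x := homog_part false _; set y := homog_part true _.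
have E : x + y = u + v by apply: homog_part_sum.
have E' : x - u = v - y by apply/eqP; rewrite subr_eq addrAC eq_sym subr_eq addrC -E addrC.
have xu : x - u = 0.
  apply: vsa_homog_direct; first by apply: homogB => //; apply: homog_part_homog.
  by rewrite E'; apply: homogB => //; apply: homog_part_homog.
by split; apply/eqP; rewrite -subr_eq0 ?xu// -opprB oppr_eq0 -E' xu.
Qed.

Lemma homog_part_id b u : vsa_homog b u -> homog_part b u = u.
Proof.
case: b => hu.
  have h0 : vsa_homog false (0 : V) by case: (@vsa_homog_subspace K V false).
  by have [_] := homog_part_uniq h0 hu; rewrite add0r.
have h0 : vsa_homog true (0 : V) by case: (@vsa_homog_subspace K V true).
by have [] := homog_part_uniq hu h0; rewrite addr0.
Qed.

Lemma homog_part_neg b u : vsa_homog b u -> homog_part (~~ b) u = 0.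
Proof.
move=> hu; have := homog_part_sum u; case: b hu => hu; rewrite -[in RHS](homog_part_id hu) /=.
  by move=> /eqP; rewrite -subr_eq0 addrK => /eqP.
by move=> /eqP; rewrite -subr_eq0 addrC addKr => /eqP.
Qed.

Lemma homog_part_linear b : linear (homog_part b).
Proof.
move=> a u v.
have [h0 h1] : homog_part false (a *: u + v) = a *: homog_part false u + homog_part false v /\
               homog_part true (a *: u + v) = a *: homog_part true u + homog_part true v.
  rewrite -{1 3}(homog_part_sum u) -{1 3}(homog_part_sum v) scalerDr addrACA;
    apply: homog_part_uniq;
  by apply: homogD; first apply: vsa_homogZ; apply: homog_part_homog.
by case: b.
Qed.
HB.instance Definition _ b := GRing.isLinear.Build K V V *:%R (homog_part b) (homog_part_linear b).

Lemma homog_part_D b u : homog_part b (vsa_D u) = vsa_D (homog_part b u).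
Proof.
have h c : vsa_homog c (vsa_D (homog_part c u)) by apply: vsa_homog_D; apply: homog_part_homog.
rewrite -{1}(homog_part_sum u) linearD /=.
by have [h0 h1] := homog_part_uniq (h false) (h true); case: b.
Qed.

Lemma homog_part_vacuum b : homog_part b (vsa_vacuum V) = if b then 0 else vsa_vacuum V.
Proof. by case: b; [apply: (homog_part_neg (b := false)) | apply: homog_part_id];
  apply: vsa_homog_vacuum. Qed.

(** The letter [(b, u, n)] stands for [u_b[n]], where [u_b] is the part of [u] of parity [b]. *)
Definition letter : Type := (bool * V * int)%type.
Implicit Types x y z : letter.

Definition bracket x y : letter :=
  (x.1.1 (+) y.1.1, emode x.2 (homog_part x.1.1 x.1.2) (homog_part y.1.1 y.1.2), x.2 + y.2).

Definition koszul x y : K := (-1) ^+ (x.1.1 && y.1.1).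

Lemma koszulC x y : koszul x y = koszul y x.
Proof. by rewrite /koszul andbC. Qed.

End Letters.

Arguments homog_part : simpl never.

(** * The coinduced module *)

Section Action.
Context {K : numFieldType} (V : vertexSuperalgebra K) (N E : lmodType K).
Variable op : bool -> V -> nat -> N -> N.
Implicit Types (x y z : letter V) (n : N) (b c : bool) (u v : V) (k : int).

(** A module [N] over the part of nonnegative degree, on which [1[0]] is the identity; [op b u i]
is the action of the letter [(b, u, i)]. *)
Record nonneg_module : Prop := NonnegModule {
  nnm_linear b u i : linear (op b u i);
  nnm_linearl b i n : linear (fun u => op b u i n);
  nnm_D b u i n : op b (vsa_D u) i n = - (i%:R *: op b u i n);
  nnm_vacuum b i n : op b (vsa_vacuum V) i n = if ~~ b && (i == 0%N) then n else 0;
  nnm_comm b c u v i j n :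
    op b u i (op c v j n) - (-1) ^+ (b && c) *: op c v j (op b u i n) =
    op (b (+) c) (emode i (homog_part b u) (homog_part c v)) (i + j) n
}.

(** Letters of negative degree: [(b, u, i)] has degree [-(i+1)], matching the constructor
[Negz]. *)
Definition nletter : Type := (bool * V * nat)%type.
Definition neg_letter (y : nletter) : letter V := (y.1.1, y.1.2, Negz y.2).
Arguments neg_letter : simpl never.
(** The coherent functions among these are the linear maps from [U(L_+) (x) N] to [E].  Bundling the
type as a module keeps a single instance of each operation. *)
Definition word_fun : lmodType K := (seq nletter -> N -> E : Type).
Implicit Types f g : word_fun.

Definition shift (s : seq nletter) f : word_fun := fun w => f (s ++ w).

(** [f(x w, n)] for a letter [x] in front of [w].  A letter of negative degree just lengthens the
word.  Any other letter moves to the right by [x y = +- y x + [x,y]], where [[x,y]] is again one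
letter but of either kind; at the end of the word it acts on [n]. *)
Fixpoint act_rec (w : seq nletter) f b u k {struct w} : N -> E :=
  match k with
  | Negz i => f ((b, u, i) :: w)
  | Posz i =>
    match w with
    | [::] => fun n => f [::] (op b u i n)
    | y :: w' => fun n => koszul (b, u, k) (neg_letter y) *: act_rec w' (shift [:: y] f) b u k n
        + let z := bracket (b, u, k) (neg_letter y) in act_rec w' f z.1.1 z.1.2 z.2 n
    end
  end.
Definition act f x : word_fun := fun w => act_rec w f x.1.1 x.1.2 x.2.
Arguments act : simpl never.
Local Notation "f \> x" := (act f x) (at level 40, left associativity, format "f  \>  x").

Lemma actN f (y : nletter) : f \> neg_letter y = shift [:: y] f.
Proof. by apply/funext => -[|? ?]; case: y => -[]. Qed.

Lemma act_nil f b u (i : nat) n : (f \> (b, u, i%:Z)) [::] n = f [::] (op b u i n).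
Proof. by []. Qed.

Lemma act_cons f b u (i : nat) (y : nletter) : f \> (b, u, i%:Z) \> neg_letter y =
  koszul (b, u, i%:Z) (neg_letter y) *: (f \> neg_letter y \> (b, u, i%:Z)) + f \> bracket
    (b, u, i%:Z) (neg_letter y).
Proof. by apply/funext => w; rewrite !actN. Qed.

(** Linearity in [f] holds for all functions; linearity in the vector of the letter needs [f]
coherent. *)
Lemma act_is_linear x : linear (act^~ x).
Proof.
move=> a f g; case: x => -[b u] k; apply/funext => w; apply/funext => n; rewrite /act /=.
suff: forall w f g b u k, act_rec w (a *: f + g) b u k n =
  a *: act_rec w f b u k n + act_rec w g b u k n by [].
elim=> [|y w' IH] f' g' b' u' [i|i] //=.
rewrite -[shift _ _]/(a *: shift [:: y] f' + shift [:: y] g') !IH.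
lmod_eq.
Qed.

Lemma act_lin a f g x : (a *: f + g) \> x = a *: (f \> x) + g \> x.
Proof. exact: act_is_linear. Qed.

Lemma word_fun_linE a f g w n : (a *: f + g) w n = a *: f w n + g w n.
Proof. by []. Qed.

(** The relations of [U(L_+)] at the front of the word. *)
Record local_rel f : Prop := LocalRel {
  lr_linear : linear (f [::]);
  lr_letter c i : linear (fun u => f \> neg_letter (c, u, i));
  lr_D c i u : f \> neg_letter (c, vsa_D u, i) = - ((Negz i)%:~R *: (f \> neg_letter (c, u, i)));
  lr_comm (x y : nletter) :
    f \> neg_letter x \> neg_letter y - koszul (neg_letter x) (neg_letter y) *:
      (f \> neg_letter y \> neg_letter x) = f \> bracket (neg_letter x) (neg_letter y)
}.

(** The relations hold at every place: a prefix [s] is first absorbed into the function. *)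
Definition coherent f := forall s, local_rel (shift s f).

Lemma coherent_local f : coherent f -> local_rel f.
Proof. by move=> /(_ [::]). Qed.

Lemma coherent_shift f (y : nletter) : coherent f -> coherent (shift [:: y] f).
Proof. by move=> hf s; apply: (hf (y :: s)). Qed.

Lemma local_rel_lin a f g : local_rel f -> local_rel g -> local_rel (a *: f + g).
Proof.
move=> [fl fu fD fc] [gl gu gD gc]; split=> [a' n n'|c i a' u v|c i u|x y].
- by rewrite !word_fun_linE fl gl; lmod_eq.
- by rewrite /= !act_lin fu gu; lmod_eq.
- by rewrite !act_lin fD gD; lmod_eq.
- by rewrite !act_lin -fc -gc; lmod_eq.
Qed.

Lemma coherent_lin a f g : coherent f -> coherent g -> coherent (a *: f + g).
Proof. by move=> hf hg s; apply: (local_rel_lin a (hf s) (hg s)). Qed.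

Hypothesis opP : nonneg_module.

Lemma act_consE f b u (i : nat) (y : nletter) w n :
  (f \> (b, u, i%:Z)) (y :: w) n =
  koszul (b, u, i%:Z) (neg_letter y) *: (f \> neg_letter y \> (b, u, i%:Z)) w n
  + (f \> bracket (b, u, i%:Z) (neg_letter y)) w n.
Proof. by rewrite actN. Qed.

Lemma act_letter_lin f c k a u v : coherent f ->
  f \> (c, a *: u + v, k) = a *: (f \> (c, u, k)) + f \> (c, v, k).
Proof.
suff H w : forall g, coherent g -> forall d k' u' v' n, (g \> (d, a *: u' + v', k')) w n =
    (a *: (g \> (d, u', k')) + g \> (d, v', k')) w n.
  by move=> hf; apply/funext => w; apply/funext => n; apply: H.
elim: w => [|y w IH] {}f hf {}c [i|i] {}u {}v n;
  try by have /(_ a u v) /= := lr_letter (coherent_local hf) c i; rewrite /neg_letter /= => ->.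
  rewrite word_fun_linE !act_nil nnm_linearl//.
  exact: (lr_linear (coherent_local hf)).
rewrite word_fun_linE !act_consE IH; last by rewrite actN; apply: coherent_shift.
rewrite word_fun_linE /bracket /= homog_part_linear emode_linearl IH// word_fun_linE /koszul /=;
  lmod_eq.
Qed.

(** Takes the proof of coherence as an argument because without it the map is not linear. *)
Definition letter_map f (hf : coherent f) c k u : word_fun := f \> (c, u, k).
HB.instance Definition _ f hf c k := GRing.isLinear.Build K V word_fun *:%R (@letter_map f hf c k)
  (fun a u v => act_letter_lin c k a u v hf).

Lemma act_letter0 f c k : coherent f -> f \> (c, 0, k) = 0.
Proof. by move=> hf; apply: (linear0 (letter_map hf c k)). Qed.

Lemma act_letterZ f c k a u : coherent f -> f \> (c, a *: u, k) = a *: (f \> (c, u, k)).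
Proof. by move=> hf; apply: (linearZ_LR (letter_map hf c k)). Qed.

(** The part of the relation [(D u)[k] = -k u[k]] of negative degree is assumed; for [k >= 0] it moves
along the word because [B_k(D u, v) = -k B_k(u, v)]. *)
Lemma act_letterD f c k u : coherent f ->
  f \> (c, vsa_D u, k) = - (k%:~R *: (f \> (c, u, k))).
Proof.
suff H w : forall g, coherent g -> forall d k' u' n, (g \> (d, vsa_D u', k')) w n =
    (- (k'%:~R *: (g \> (d, u', k')))) w n.
  by move=> hf; apply/funext => w; apply/funext => n; apply: H.
have EN (g : word_fun) (x : K) w' n : (- (x *: g)) w' n = - (x *: g w' n) by [].
elim: w => [|y w IH] {}f hf {}c [i|i] {}u n;
  try by have /(_ u) := lr_D (coherent_local hf) c i; rewrite /neg_letter /= => ->.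
  rewrite EN !act_nil nnm_D// -scaleNr -[_ *: _]addr0 (lr_linear (coherent_local hf)).
  have -> : f [::] 0 = 0.
    by have := lr_linear (coherent_local hf) (-1) 0 0; rewrite scaler0 addr0 scaleN1r addNr.
  by rewrite addr0 scaleNr.
rewrite EN !act_consE IH; last by rewrite actN; apply: coherent_shift.
rewrite EN /bracket /= homog_part_D (emode_Dl _ _ (homog_part_homog _ _)) -scaleNr act_letterZ//.
rewrite -[(_ *: (f \> _)) w n]/(_ *: (f \> _) w n) /koszul /=.
lmod_eq.
Qed.

(** [1[i]] is central, since [B_i(1, v) = 0], and so is passed on unchanged to [N]. *)
Lemma act_vacuum f b i : coherent f ->
  f \> (b, vsa_vacuum V, Posz i) = if ~~ b && (i == 0%N) then f else 0.
Proof.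
suff H w : forall g, coherent g -> forall n, (g \> (b, vsa_vacuum V, Posz i)) w n =
    (if ~~ b && (i == 0%N) then g else 0) w n.
  by move=> hf; apply/funext => w; apply/funext => n; apply: H.
elim: w => [|y w IH] {}f hf n.
  rewrite act_nil nnm_vacuum//; case: ifP => // _.
  by have := lr_linear (coherent_local hf) (-1) 0 0; rewrite scaler0 addr0 scaleN1r addNr.
rewrite act_consE IH; last by rewrite actN; apply: coherent_shift.
rewrite /bracket /=; have -> : emode i%:Z (homog_part b (vsa_vacuum V)) (homog_part y.1.1 y.1.2) =
  0.
  by rewrite homog_part_vacuum; case: b {IH}; [apply: (linear0
    (emode_left _ _)) | rewrite emode_vacuum].
rewrite act_letter0//.
case: b {IH} => /=; first by rewrite scaler0 addr0.
by rewrite /koszul /= expr0 scale1r; case: ifP => _; rewrite ?actN; apply: addr0.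
Qed.

(** [emode_skew] for the functional [u |-> f.(c, u, k)], which satisfies the condition on [D] by
[act_letterD]. *)
Lemma act_skew f x y : coherent f -> f \> bracket y x = - (koszul x y *: (f \> bracket x y)).
Proof.
move=> hf; rewrite /bracket addbC [y.2 + _]addrC.
rewrite -[LHS]/(letter_map hf _ _ _) -[f \> _]/(letter_map hf _ _ _).
apply: emode_skew; [|exact: homog_part_homog|exact: homog_part_homog].
by move=> w; apply: act_letterD.
Qed.

Lemma act_jacobi f x y z : coherent f ->
  f \> bracket x (bracket y z) = koszul x y *: (f \> bracket y (bracket x z)) + f \> bracket
    (bracket x y) z.
Proof.
move=> hf; rewrite /bracket /= !(@homog_part_id _ _ (_ (+) _)); first last.
- by apply: vsa_homog_emode; apply: homog_part_homog.
- by apply: vsa_homog_emode; apply: homog_part_homog.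
- by apply: vsa_homog_emode; apply: homog_part_homog.
rewrite (addbCA y.1.1) (addrCA y.2) -addbA -addrA -act_letter_lin//.
congr (_ \> (_, _, _)).
by rewrite -(emode_jacobi _ _ _ (homog_part_homog _ _) (homog_part_homog _ _)) [RHS]addrC subrK.
Qed.

(** If [x] has nonnegative degree this is how [act] was defined, and otherwise it is part of
coherence. *)
Lemma act_comm_neg f x (y : nletter) : coherent f ->
  f \> x \> neg_letter y = koszul x (neg_letter y) *: (f \> neg_letter y \> x) + f \> bracket x
    (neg_letter y).
Proof.
move=> hf; case: x => -[b u] [i|i]; first exact: act_cons.
by rewrite -[(b, u, Negz i)]/(neg_letter (b, u, i)) -(lr_comm (coherent_local hf)) addrC subrK.
Qed.

Lemma act_bracket_lin f x c k a u v : coherent f ->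
  f \> bracket x (c, a *: u + v, k) = a *: (f \> bracket x (c, u, k)) + f \> bracket x (c, v, k).
Proof. by move=> hf; rewrite /bracket /= homog_part_linear linearP act_letter_lin. Qed.

Lemma act_bracket_D f x c k u : coherent f ->
  f \> bracket x (c, vsa_D u, k) = - (k%:~R *: (f \> bracket x (c, u, k))).
Proof.
move=> hf; rewrite /bracket /= homog_part_D (emode_Dr _ (homog_part_homog _ _)
  (homog_part_homog _ _)) addrC.
by rewrite act_letter_lin// act_letterD// intrD; lmod_eq.
Qed.

Lemma koszul_bracket x y z : koszul (bracket x y) z = koszul x z * koszul y z.
Proof. by rewrite /koszul /=; case: x.1.1; case: y.1.1; case: z.1.1 => /=; ring. Qed.

Lemma koszul_cases x y : koszul x y = 1 \/ koszul x y = -1.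
Proof. by rewrite /koszul; case: (_ && _); [right; rewrite expr1 | left; rewrite expr0]. Qed.

Lemma act0l x : 0 \> x = 0.
Proof. by have := act_lin (-1) 0 0 x; rewrite scaler0 addr0 scaleN1r addNr. Qed.

Lemma actZl a f x : (a *: f) \> x = a *: (f \> x).
Proof. by have := act_lin a f 0 x; rewrite act0l !addr0. Qed.

Lemma actNl f x : (- f) \> x = - (f \> x).
Proof. by rewrite -[- f]scaleN1r actZl scaleN1r. Qed.

Lemma bracket_neg (y z : nletter) : exists p, bracket (neg_letter y) (neg_letter z) = neg_letter p.
Proof.
exists (y.1.1 (+) z.1.1, emode (Negz y.2) (homog_part y.1.1 y.1.2) (homog_part z.1.1 z.1.2),
  (y.2 + z.2).+1).
by rewrite /bracket /neg_letter /=; congr (_, _, _); lia.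
Qed.

(** Expressing both [f.x.y.z] and [f.x.z.y] by [act_comm_neg] moves [x] to the last place, where the
relation between [y] and [z] is known for [f]; the remaining double brackets cancel by the Jacobi
identity. *)
Lemma local_rel_act f x : coherent f -> local_rel (f \> x).
Proof.
case: x => -[b u] [i|i] hf; last first.
  by rewrite -[(b, u, Negz i)]/(neg_letter (b, u, i)) actN; apply/coherent_local/coherent_shift.
set x := (b, u, Posz i).
have hs (y : nletter) : coherent (f \> neg_letter y) by rewrite actN; apply: coherent_shift.
split=> [a n n'|c j a v v'|c j v|y z].
- by rewrite !act_nil nnm_linear// (lr_linear (coherent_local hf)).
- rewrite !act_comm_neg// act_bracket_lin//.
  have /(_ a v v') /= -> := lr_letter (coherent_local hf) c j.
  by rewrite !act_lin /koszul /neg_letter /=; lmod_eq.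
- rewrite !act_comm_neg// act_bracket_D// (lr_D
  (coherent_local hf)) actNl actZl /koszul /neg_letter /=.
  by lmod_eq.
have [p yz] := bracket_neg y z.
rewrite [f \> x \> neg_letter y]act_comm_neg// [f \> x \> neg_letter z]act_comm_neg// !act_lin.
rewrite (act_comm_neg x z (hs y)) (act_comm_neg x y (hs z)).
rewrite (act_comm_neg (bracket x (neg_letter y)) z hf) (act_comm_neg (bracket x
  (neg_letter z)) y hf).
rewrite (act_comm_neg (neg_letter y) z hf) act_lin yz (act_comm_neg x p hf) -yz.
rewrite act_jacobi// (act_skew (bracket x (neg_letter z)) (neg_letter y))//.
rewrite (koszulC x (bracket _ _)) !koszul_bracket (koszulC (neg_letter y) x) (koszulC
  (neg_letter z) x) (koszulC (neg_letter z) (neg_letter y)).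
case: (koszul_cases x (neg_letter y)) => ->; case: (koszul_cases x (neg_letter z)) => ->;
  case: (koszul_cases (neg_letter y) (neg_letter z)) => ->; lmod_eq.
Qed.

(** Absorbing a letter [y] of the prefix turns [f.x] into [+- f.y.x + f.[x,y]] and leaves a
shorter prefix; the degree of [[x,y]] may have either sign, so the induction is over all [x]. *)
Lemma coherent_act f x : coherent f -> coherent (f \> x).
Proof.
move=> hf s; elim: s f x hf => [|y s IH] f x hf; first exact: (local_rel_act x hf).
have -> : shift (y :: s) (f \> x) = shift s (f \> x \> neg_letter y) by rewrite actN.
rewrite act_comm_neg//.
apply: (local_rel_lin _ (IH _ _ _) (IH _ _ hf)).
by rewrite actN; apply: coherent_shift.
Qed.

(** The module axiom.  If one letter has negative degree this is [act_comm_neg], up to skew-symmetry.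
For two letters [x], [x'] of nonnegative degree, evaluation at a word [y w] is evaluation of
[f.x.x'.y] at [w].  Moving [y] to the front leaves commutators of [x] with [x'], of [x] with
[[x',y]] and of [x'] with [[x,y]], all known at the shorter word [w], and the Jacobi identity. *)
Lemma act_comm f x y : coherent f -> f \> x \> y = koszul x y *: (f \> y \> x) + f \> bracket x y.
Proof.
case: y => -[c v] [j|j] hf; last exact: (act_comm_neg x (c, v, j)).
case: x => -[b u] [i|i]; last first.
  rewrite -[(b, u, Negz i)]/(neg_letter (b, u, i)).
  rewrite (act_comm_neg (c, v, Posz j) (b, u, i) hf) (act_skew (neg_letter (b, u, i)))//.
  by rewrite (koszulC _ (neg_letter _)); case: (koszul_cases (neg_letter (b, u, i))
    (c, v, Posz j)) => ->; lmod_eq.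
suff H w : forall g, coherent g -> forall b c u v (i j : nat) n,
    (g \> (b, u, i%:Z) \> (c, v, j%:Z)) w n =
    (koszul (b, u, i%:Z) (c, v, j%:Z) *: (g \> (c, v, j%:Z) \> (b, u, i%:Z))
      + g \> bracket (b, u, i%:Z) (c, v, j%:Z)) w n.
  by apply/funext => w; apply/funext => n; apply: H.
elim: w {f hf b c u v i j} => [|y w IH] f hf b c u v i j n.
  rewrite word_fun_linE !act_nil /=.
  rewrite -(lr_linear (coherent_local hf)) -(nnm_comm opP b c u v i j n) addrC.
  by rewrite subrK.
set x := (b, u, Posz i); set x' := (c, v, Posz j).
have hs : coherent (f \> neg_letter y) by rewrite actN; apply: coherent_shift.
have IHx z g : coherent g -> (g \> x \> z) w n = (koszul x z *: (g \> z \> x) +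
  g \> bracket x z) w n.
  move=> hg; case: z => -[d t] [k|k]; first exact: IH.
  by rewrite (act_comm_neg x (d, t, k)).
have IHx' z g : coherent g -> (g \> x' \> z) w n = (koszul x' z *: (g \> z \> x') +
  g \> bracket x' z) w n.
  move=> hg; case: z => -[d t] [k|k]; first exact: IH.
  by rewrite (act_comm_neg x' (d, t, k)).
have S g : g (y :: w) n = (g \> neg_letter y) w n by rewrite actN.
rewrite word_fun_linE !S (act_comm_neg x' y (coherent_act x hf)) (act_comm_neg x y
  (coherent_act x' hf)).
rewrite (act_comm_neg x y hf) (act_comm_neg x' y hf) (act_comm_neg (bracket x x') y hf).
rewrite !act_lin !word_fun_linE (IHx x' _ hs) (IHx _ _ hf)
  (IHx' _ _ hf) !word_fun_linE act_jacobi//.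
rewrite word_fun_linE (koszulC x (bracket _ _)) (koszulC x'
  (bracket _ _)) !koszul_bracket !(koszulC (neg_letter y)) (koszulC x' x).
case: (koszul_cases x x') => ->; case: (koszul_cases x (neg_letter y)) => ->;
  case: (koszul_cases x' (neg_letter y)) => ->; lmod_eq.
Qed.

End Action.

(** * Presented algebras, free algebras and tensor products *)

Section QuotientAlgebras.
Context {K : comNzRingType} {F : algType K} (S : set F).

Lemma mem_ideal x : S x -> x \in ideal S.
Proof. by move=> Sx; apply/asboolP => A [_]; apply. Qed.

Lemma ideal_sub (A : set F) : is_ideal A -> S `<=` A -> forall x, x \in ideal S -> A x.
Proof. by move=> IA SA x /asboolP; apply. Qed.

Lemma quotalg_rel x y : S (x - y) -> quotalg_pi S x = quotalg_pi S y.
Proof. by move=> Sxy; apply/quotalg_piP; apply: mem_ideal. Qed.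

Variable G : set (quotalg S).

Lemma mem_subalg x : G x -> x \in subalg G.
Proof. by move=> Gx; apply/asboolP => A [_]; apply. Qed.

Lemma subalg_sub (A : set (quotalg S)) :
  is_subalgebra A -> G `<=` A -> forall x, x \in subalg G -> A x.
Proof. by move=> SA GA x /asboolP; apply. Qed.

Lemma subalg1 : 1 \in subalg G.
Proof. by apply/asboolP => A [[]]. Qed.

Lemma subalgM x y : x \in subalg G -> y \in subalg G -> x * y \in subalg G.
Proof.
move=> /asboolP hx /asboolP hy; apply/asboolP => A [AS GA].
by case: (AS) => _ _; apply; [apply: hx | apply: hy].
Qed.

(** The elements [x] for which [P] is stable under left multiplication by [x] form a subalgebra. *)
Lemma subalg_ind_left (P : set (quotalg S)) : is_subspace P -> P 1 ->
  (forall g y, G g -> P y -> P (g * y)) -> forall x, x \in subalg G -> P x.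
Proof.
move=> [P0 PD] P1 PM x xG; rewrite -[x]mulr1; move: x xG 1 P1.
apply: subalg_sub => [|g Gg y Py]; last exact: PM.
split; first split=> [y _|a u v hu hv y Py]; rewrite ?mul0r//.
- by rewrite mulrDl -quotalg_scalerAl; apply: PD; [apply: hu | apply: hv].
- by move=> y Py; rewrite mul1r.
- by move=> u v hu hv y Py; rewrite -mulrA; apply: hu; apply: hv.
Qed.

Lemma subalg_ind_right (P : set (quotalg S)) : is_subspace P -> P 1 ->
  (forall g y, G g -> P y -> P (y * g)) -> forall x, x \in subalg G -> P x.
Proof.
move=> [P0 PD] P1 PM x xG; rewrite -[x]mul1r; move: x xG 1 P1.
apply: subalg_sub => [|g Gg y Py]; last exact: PM.
split; first split=> [y _|a u v hu hv y Py]; rewrite ?mulr0//.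
- by rewrite mulrDr -quotalg_scalerAr; apply: PD; [apply: hu | apply: hv].
- by move=> y Py; rewrite mulr1.
- by move=> u v hu hv y Py; rewrite mulrA; apply: hv; apply: hu.
Qed.

End QuotientAlgebras.

Section FreeAlgebraInduction.
Context {K : numFieldType} {X : choiceType}.
Local Notation F := (free_alg K X).

Lemma free_genM (x : X) (m : {fmonom X}) :
  free_gen x * << m >> = << FMonom (x :: m) >> :> F.
Proof.
rewrite /free_gen (malgM_def (<< fmu x >> : {malg K[{fmonom X}]})) fgmulUU mulr1.
by congr << _ >>; apply/eqP; rewrite fmP fmM fmU.
Qed.

Lemma free_alg_basis_ind (P : F -> Prop) :
  (forall m : {fmonom X}, P << m >>) ->
  (forall a g h, P g -> P h -> P (a *: g + h)) -> forall g, P g.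
Proof.
move=> Pm PD g; rewrite (monalgE (g : {malg K[{fmonom X}]})).
elim/big_rec: _ => [|m h _ Ph].
  by have := PD (-1) _ _ (Pm (FMonom [::])) (Pm (FMonom [::])); rewrite scaleN1r addNr.
suff -> : << g@_m *g m >> = g@_m *: << m >> :> F by apply: PD.
by apply/malgP => k; rewrite [RHS]mcoeffZ !mcoeffU mulrnAr mulr1.
Qed.

Lemma free_alg_ind (P : F -> Prop) : P 1 ->
  (forall a g h, P g -> P h -> P (a *: g + h)) ->
  (forall x g, P g -> P (free_gen x * g)) -> forall g, P g.
Proof.
move=> P1 PD PM; apply: free_alg_basis_ind => // -[s]; elim: s => [|x s IH].
  by rewrite -[FMonom [::]]fmoneE.
by rewrite -[FMonom _]/(FMonom (x :: FMonom s)) -free_genM; apply: PM.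
Qed.

(** This and the next lemma combine two rules so that the module structure in the result is the one
that linear maps expect. *)
Lemma free_mulDr (x p q : F) (a : K) : x * (a *: p + q) = a *: (x * p) + x * q.
Proof. by rewrite mulrDr -scalerAr. Qed.

Lemma free_mulDl (x p q : F) (a : K) : (a *: p + q) * x = a *: (p * x) + q * x.
Proof. by rewrite mulrDl -scalerAl. Qed.

Lemma free_mulA (x p q : F) : x * p * q = x * (p * q).
Proof. by rewrite mulrA. Qed.

Lemma lin_ext_monom (M : lmodType K) (f : {fmonom X} -> M) (m : {fmonom X}) :
  lin_ext f (<< m >> : F) = f m.
Proof. exact: lin_extU. Qed.

End FreeAlgebraInduction.

Section TensorLemmas.
Context {K : numFieldType} (A B : lmodType K).

Lemma pure_linearl (b : B) : linear (fun a : A => pure a b).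
Proof.
move=> c a a'; rewrite /pure -linearP; apply/quot_piP; apply: mem_span.
exact: TensorRelL.
Qed.

Lemma pure_linearr (a : A) : linear (fun b : B => pure a b).
Proof.
move=> c b b'; rewrite /pure -linearP; apply/quot_piP; apply: mem_span.
exact: TensorRelR.
Qed.

Lemma tensor_ind (P : tensor A B -> Prop) :
  (forall a b, P (pure a b)) -> (forall c x y, P x -> P y -> P (c *: x + y)) ->
  forall t, P t.
Proof.
move=> Pp PD t.
have P0 : P 0 by have := PD (-1) _ _ (Pp 0 0) (Pp 0 0); rewrite scaleN1r addNr.
rewrite -[t](@quot_reprK _ _ (span (@tensor_rel K A B))).
rewrite (monalgE (quot_repr _)) linear_sum; elim/big_rec: _ => // -[a b] x _ Px.
set k := (_ @_ _).
have -> : << k *g (a, b) >> = k *: << (a, b) >> :> {malg K[(A * B)%type]}.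
  by apply/malgP => w; rewrite mcoeffZ !mcoeffU mulrnAr mulr1.
by rewrite linearZ; apply: PD => //; apply: Pp.
Qed.

End TensorLemmas.

(** * Relations between the generators *)

Section Relations.
Context {K : numFieldType} (V : vertexSuperalgebra K).
Implicit Types (b c : bool) (u v : V) (m n : int) (x y z : letter V).
Local Notation W := (U_zero_minus V).
Local Notation "1v" := (vsa_vacuum V).

Lemma U_scaleAl (a : K) (p q : U V) : a *: (p * q) = (a *: p) * q.
Proof. exact: quotalg_scalerAl. Qed.

Lemma U_scaleAr (a : K) (p q : U V) : a *: (p * q) = p * (a *: q).
Proof. exact: quotalg_scalerAr. Qed.

Lemma U_gen_linear n : linear (fun u => U_gen u n).
Proof.
move=> a u v; rewrite /U_gen -linearP; apply: quotalg_rel.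
exact: U_rel_linear.
Qed.

Lemma U_gen_vacuum n : U_gen 1v n = (n == 0)%:R :> U V.
Proof.
have -> : (n == 0)%:R = quotalg_pi (@U_rel K V) (n == 0)%:R by rewrite rmorph_nat.
by apply: quotalg_rel; apply: U_rel_vacuum.
Qed.

Lemma U_gen_D u n : U_gen (vsa_D u) n = - (n%:~R *: U_gen u n).
Proof.
rewrite /U_gen -linearZ -linearN; apply: quotalg_rel.
by rewrite opprK; apply: U_rel_D.
Qed.

Definition U_mode n u : U V := U_gen u n.
HB.instance Definition _ n :=
  GRing.isLinear.Build K V (U V) *:%R (U_mode n) (U_gen_linear n).

Lemma U_gen_comm b c u v m n : vsa_homog b u -> vsa_homog c v ->
  U_gen u m * U_gen v n =
  (-1) ^+ (b && c) *: (U_gen v n * U_gen u m) + U_gen (emode m u v) (m + n).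
Proof.
move=> hu hv; pose N := vsa_bound u v.
have hN (j : nat) : (N <= j)%N -> vsa_mode u j v = 0 by apply: vsa_boundP.
have -> : U_gen (emode m u v) (m + n) = quotalg_pi (@U_rel K V)
    (\sum_(j < N) expc m%:~R j *: free_gen (vsa_mode u j%:Z v, m + n)).
  rewrite (emodeE _ hN) -[LHS]/(U_mode _ _) !linear_sum; apply: eq_bigr => j _.
  by rewrite [LHS]linearZ [RHS]linearZ.
rewrite /U_gen -!rmorphM -linearZ -linearD; apply: quotalg_rel.
by rewrite opprD addrA; apply: U_rel_comm.
Qed.

Local Opaque U_gen.

(** Locked: the image of a generator in the quotient otherwise unfolds to a choice of representative
whenever two products are compared. *)
Fact U_letter_key : unit. Proof. exact: tt. Qed.
Definition U_letter := locked_with U_letter_key (fun x => U_gen (homog_part x.1.1 x.1.2) x.2 : U V).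

Lemma U_letterE x : U_letter x = U_gen (homog_part x.1.1 x.1.2) x.2.
Proof. by rewrite /U_letter unlock. Qed.

Lemma U_letter_linear b n : linear (fun u => U_letter (b, u, n)).
Proof. by move=> a u v; rewrite !U_letterE /= linearP /= U_gen_linear. Qed.

Lemma U_letter_D b u n : U_letter (b, vsa_D u, n) = - (n%:~R *: U_letter (b, u, n)).
Proof. by rewrite !U_letterE /= homog_part_D U_gen_D. Qed.

Lemma U_letter_vacuum b (n : int) : U_letter (b, 1v, n) = if b then 0 else (n == 0)%:R.
Proof.
rewrite !U_letterE /= homog_part_vacuum; case: b; last exact: U_gen_vacuum.
exact: (linear0 (U_mode n)).
Qed.

Lemma U_letter_comm x y : U_letter x * U_letter y = koszul x y *: (U_letter y * U_letter x) +
  U_letter (bracket x y).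
Proof.
have h : vsa_homog (x.1.1 (+) y.1.1) (bracket x y).1.2.
  by apply: vsa_homog_emode; apply: homog_part_homog.
rewrite !U_letterE (homog_part_id h); exact: (U_gen_comm _ _ (homog_part_homog _ _)
  (homog_part_homog _ _)).
Qed.

Lemma U_letter_sum u n : U_letter (false, u, n) + U_letter (true, u, n) = U_gen u n.
Proof. by rewrite !U_letterE /= -(linearD (U_mode n)) /= homog_part_sum. Qed.

End Relations.

(** * The subalgebra of nonnegative degree *)

Section NonnegativePart.
Context {K : numFieldType} (V : vertexSuperalgebra K).
Implicit Types (b c : bool) (u v : V) (x y z : letter V).
Local Notation W := (U_zero_minus V).
Local Notation "1v" := (vsa_vacuum V).
Local Opaque U_gen.

Lemma zero_minus_mulr (p q : U V) : p \in W -> q \in U_minus V -> p * q \in W.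
Proof.
move=> pW qm; move: p pW; apply: span_sub => [|_ [a [b [a0 bm ->]]]].
  split=> [|a p p' hp hp'] /=; first by rewrite mul0r rpred0.
  by rewrite mulrDl -U_scaleAl; apply: rpredD; [apply: rpredZ; apply: hp|apply: hp'].
by rewrite /= -mulrA; apply: mem_span; exists a, (b * q); split=> //; apply: subalgM.
Qed.

Lemma zero_minus_mul0 u (p : U V) : p \in W -> U_gen u 0 * p \in W.
Proof.
move=> pW; move: p pW; apply: span_sub => [|_ [a [b [a0 bm ->]]]].
  split=> [|a p p' hp hp'] /=; first by rewrite mulr0 rpred0.
  by rewrite mulrDr -U_scaleAr; apply: rpredD; [apply: rpredZ; apply: hp|apply: hp'].
rewrite /= mulrA; apply: mem_span; exists (U_gen u 0 * a), b; split=> //.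
by apply: subalgM => //; apply: mem_subalg; exists u.
Qed.

Lemma zero_minus_mem (p q : U V) : p \in U_zero V -> q \in U_minus V -> p * q \in W.
Proof. by move=> hp hq; apply: mem_span; exists p, q. Qed.

Lemma zero_minus1 : 1 \in W.
Proof. by rewrite -[1]mulr1; apply: zero_minus_mem; apply: subalg1. Qed.

(** A generator of positive degree moves across those of degree [0]; each bracket it produces has the
same positive degree, so it can be moved on in the same way. *)
Lemma zero_minus_push u (i : nat) (p : U V) : p \in U_zero V ->
  U_gen u i.+1%:Z * p \in W.
Proof.
move=> p0; move: p p0 u i; apply: subalg_ind_left.
- split=> [u i|a p q hp hq u i]; first by rewrite mulr0 rpred0.
  by rewrite mulrDr -U_scaleAr; apply: rpredD; [apply: rpredZ; apply: hp|apply: hq].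
- move=> u i; rewrite mulr1 -[U_gen _ _]mul1r; apply: zero_minus_mem; first exact: subalg1.
  by apply: mem_subalg; exists u, i.+1.
move=> _ p [v ->] hp u i; rewrite mulrA.
have H b c : U_letter (b, u, i.+1%:Z) * U_letter (c, v, 0) * p \in W.
  rewrite U_letter_comm mulrDl -U_scaleAl -mulrA; apply: rpredD; first apply: rpredZ.
    by rewrite U_letterE; apply: zero_minus_mul0; rewrite U_letterE; apply: hp.
  by rewrite /bracket /= addr0 U_letterE; apply: hp.
by rewrite -(U_letter_sum u) -(U_letter_sum v) !(mulrDl, mulrDr) !rpredD.
Qed.

Lemma zero_minus_mull u (i : nat) (p : U V) : p \in W -> U_gen u i%:Z * p \in W.
Proof.
case: i => [|i]; first exact: zero_minus_mul0.
move=> pW; move: p pW; apply: span_sub => [|_ [a [b [a0 bm ->]]]].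
  split=> [|a p p' hp hp'] /=; first by rewrite mulr0 rpred0.
  by rewrite mulrDr -U_scaleAr; apply: rpredD; [apply: rpredZ; apply: hp|apply: hp'].
by rewrite /= mulrA; apply: zero_minus_mulr => //; apply: zero_minus_push.
Qed.

Lemma zero_minus_op_mem b u (i : nat) (n : subsp W) : U_letter (b, u, i%:Z) * \val n \in W.
Proof. by rewrite U_letterE; apply: zero_minus_mull; apply: subsp_mem. Qed.

Definition zero_minus_op b u (i : nat) (n : subsp W) : subsp W := Subsp (zero_minus_op_mem b u i n).

Lemma zero_minus_opE b u i n : \val (zero_minus_op b u i n) = U_letter (b, u, i%:Z) * \val n.
Proof. by []. Qed.

Lemma zero_minus_module : nonneg_module zero_minus_op.
Proof.
split=> [b u i a n n'|b i n a u v|b u i n|b i n|b c u v i j n]; apply: val_inj.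
- by rewrite linearP !zero_minus_opE linearP /= mulrDr U_scaleAr.
- by rewrite linearP !zero_minus_opE /= U_letter_linear mulrDl U_scaleAl.
- by rewrite linearN linearZ !zero_minus_opE /= U_letter_D mulNr scalerN -U_scaleAl.
- rewrite zero_minus_opE U_letter_vacuum; case: b => /=; first exact: mul0r.
  case: i => [|i] /=; first by rewrite mul1r.
  exact: mul0r.
- rewrite -[LHS]/(U_letter (b, u, i%:Z) * (U_letter (c, v, j%:Z) * \val n)
    - (-1) ^+ (b && c) *: (U_letter (c, v, j%:Z) * (U_letter (b, u, i%:Z) * \val n))).
  by rewrite !mulrA U_scaleAl -mulrBl U_letter_comm addrC addKr.
Qed.

End NonnegativePart.

(** * The action of the enveloping algebra *)

Section FreeAction.
Context {K : numFieldType} (V : vertexSuperalgebra K) (N E : lmodType K).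
Variable op : bool -> V -> nat -> N -> N.
Hypothesis opP : nonneg_module op.
Implicit Types (b c : bool) (u v : V).
Local Notation word_fun := (word_fun V N E).
Implicit Types f g : word_fun.
Local Notation F := (free_alg K (V * int)%type).
Local Notation coherent := (@coherent K V N E op).
Local Notation "f \> x" := (act op f x) (at level 40, left associativity, format "f  \>  x").

Definition gen_act (p : V * int) f : word_fun :=
  f \> (false, homog_part false p.1, p.2) + f \> (true, homog_part true p.1, p.2).

Definition monom_act (s : seq (V * int)) f : word_fun := foldl (fun f p => gen_act p f) f s.

Definition free_act f (p : F) : word_fun := lin_ext (fun m : {fmonom (V * int)%type} =>
  monom_act m f) p.
HB.instance Definition _ f := GRing.Linear.copy (free_act f)
  (lin_ext (fun m : {fmonom (V * int)%type} => monom_act m f)).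

Lemma gen_act_linear p : linear (gen_act p).
Proof. by move=> a f g; rewrite /gen_act !act_lin; lmod_eq. Qed.

Lemma monom_act_linear s : linear (monom_act s).
Proof.
by elim: s => [//|p s IH] a f g; rewrite /monom_act /= -/(monom_act _ _) gen_act_linear IH.
Qed.

Lemma free_act_linear (p : F) : linear (free_act^~ p).
Proof.
move=> a f g; rewrite /free_act /lin_ext scaler_sumr -big_split; apply: eq_bigr => m _ /=.
by rewrite monom_act_linear; lmod_eq.
Qed.

Lemma free_act0l (p : F) : free_act 0 p = 0.
Proof. by have := free_act_linear p (-1) 0 0; rewrite scaler0 addr0 scaleN1r addNr. Qed.

Lemma free_act_lin f a (p q : F) : free_act f (a *: p + q) = a *: free_act f p + free_act f q.
Proof. exact: lin_ext_linear. Qed.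

Lemma free_actD f (p q : F) : free_act f (p + q) = free_act f p + free_act f q.
Proof. exact: linearD. Qed.

Lemma free_actB f (p q : F) : free_act f (p - q) = free_act f p - free_act f q.
Proof. exact: linearB. Qed.

Lemma free_actZ f a (p : F) : free_act f (a *: p) = a *: free_act f p.
Proof. exact: linearZ_LR. Qed.

Lemma free_act_sum f n (p : 'I_n -> F) : free_act f (\sum_i p i) = \sum_i free_act f (p i).
Proof. exact: linear_sum. Qed.

Lemma free_act0 f : free_act f 0 = 0.
Proof. exact: linear0. Qed.

Lemma free_act_monom f (m : {fmonom (V * int)%type}) : free_act f << m >> = monom_act m f.
Proof. exact: lin_ext_monom. Qed.

Lemma free_act1 f : free_act f 1 = f.
Proof. by rewrite [LHS]lin_ext_monom fm1. Qed.

Local Opaque free_act.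

Lemma free_act_genM f p (q : F) : free_act f (free_gen p * q) = free_act (gen_act p f) q.
Proof.
elim/(@free_alg_basis_ind K): q => [m|a q r IHq IHr].
  by rewrite free_genM !free_act_monom.
by rewrite free_mulDr [LHS]free_act_lin [RHS]free_act_lin; congr (_ *: _ + _).
Qed.

Lemma free_act_gen f p : free_act f (free_gen p) = gen_act p f.
Proof. by rewrite -[free_gen p]mulr1 free_act_genM free_act1. Qed.

Lemma free_act_gen2 f p q : free_act f (free_gen p * free_gen q) = gen_act q (gen_act p f).
Proof. by rewrite [LHS]free_act_genM free_act_gen. Qed.

Lemma free_actM f (p q : F) : free_act f (p * q) = free_act (free_act f p) q.
Proof.
elim/(@free_alg_ind K): p f => [|a p r IHp IHr|x p IHp] f; first by rewrite mul1r free_act1.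
  rewrite free_mulDl [LHS]free_act_lin [free_act f (_ + _)]free_act_lin [RHS]free_act_linear.
  by congr (_ *: _ + _); [apply: IHp | apply: IHr].
by rewrite free_mulA [LHS]free_act_genM [free_act f _]free_act_genM; apply: IHp.
Qed.

Lemma coherent_gen_act p f : coherent f -> coherent (gen_act p f).
Proof.
by move=> hf; rewrite /gen_act -[X in X + _]scale1r; apply: coherent_lin; apply: coherent_act.
Qed.

Lemma coherent_free_act f (p : F) : coherent f -> coherent (free_act f p).
Proof.
elim/(@free_alg_ind K): p f => [|a p q IHp IHq|x p IHp] f hf; first by rewrite free_act1.
  by rewrite free_act_lin; apply: coherent_lin; [apply: IHp | apply: IHq].
by rewrite free_act_genM; apply: IHp; apply: coherent_gen_act.
Qed.

Lemma gen_act_homog f b u n : coherent f -> vsa_homog b u -> gen_act (u, n) f = f \> (b, u, n).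
Proof.
move=> hf hu; rewrite /gen_act /=; case: b hu => hu; rewrite (homog_part_id hu).
  by rewrite (homog_part_neg (b := true) hu) act_letter0// add0r.
by rewrite (homog_part_neg (b := false) hu) act_letter0// addr0.
Qed.

Lemma gen_act_lin f a u v n : coherent f ->
  gen_act (a *: u + v, n) f = a *: gen_act (u, n) f + gen_act (v, n) f.
Proof. by move=> hf; rewrite /gen_act /= !linearP /= !act_letter_lin//; lmod_eq. Qed.

Definition gen_map f (hf : coherent f) n u : word_fun := gen_act (u, n) f.
HB.instance Definition _ f hf n := GRing.isLinear.Build K V word_fun *:%R (@gen_map f hf n)
  (fun a u v => gen_act_lin a u v n hf).

(** For a negative index [n], the relation [(D 1)[n] = -n 1[n]] with [D 1 = 0] and [n] invertible
gives [1[n] = 0]. *)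
Lemma gen_act_vacuum f n : coherent f -> gen_act (vsa_vacuum V, n) f = (n == 0)%:R *: f.
Proof.
move=> hf; rewrite (gen_act_homog _ hf (vsa_homog_vacuum V)); case: n => i.
  rewrite act_vacuum//=; case: i => [|i] /=; first by rewrite scale1r.
  by rewrite scale0r.
have := act_letterD opP false (Negz i) (vsa_vacuum V) hf.
rewrite /vsa_D vsa_vacuum_mode /= act_letter0// scale0r => /esym/eqP.
by rewrite oppr_eq0 scaler_eq0 intr_eq0 => /orP[//|/eqP].
Qed.

Lemma gen_act_D f u n : coherent f -> gen_act (vsa_D u, n) f = - (n%:~R *: gen_act (u, n) f).
Proof. by move=> hf; rewrite /gen_act /= !homog_part_D !act_letterD//; lmod_eq. Qed.

Lemma gen_act_comm f b c u v m n : coherent f -> vsa_homog b u -> vsa_homog c v ->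
  gen_act (v, n) (gen_act (u, m) f) =
  (-1) ^+ (b && c) *: gen_act (u, m) (gen_act (v, n) f) + gen_act (emode m u v, m + n) f.
Proof.
move=> hf hu hv.
rewrite (gen_act_homog _ hf hu) (gen_act_homog _ hf hv).
rewrite (gen_act_homog _ (coherent_act opP _ hf) hu) (gen_act_homog _ (coherent_act opP _ hf) hv).
rewrite (gen_act_homog _ hf (vsa_homog_emode _ hu hv)) act_comm//.
by rewrite /bracket /= (homog_part_id hu) (homog_part_id hv).
Qed.

(** The elements that kill all coherent functions form a two-sided ideal: it is a left ideal because
the action preserves coherence, and a right ideal because [0] is sent to [0]. *)
Lemma free_act_ideal p : p \in ideal (@U_rel K V) -> forall f, coherent f -> free_act f p = 0.
Proof.
move: p; apply: ideal_sub; first split; first split=> [f _|a p q hp hq f hf].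
- exact: free_act0.
- by rewrite free_act_lin hp// hq// scaler0 addr0.
- move=> x y hy; split=> f hf; rewrite free_actM; first by apply: hy; apply: coherent_free_act.
  by rewrite hy// free_act0l.
move=> _ [a u v n|n|u n|b c u v m n M hu hv hN] f hf.
- by rewrite [LHS]free_actB [free_act f (_ + _)]free_act_lin !free_act_gen gen_act_lin// subrr.
- rewrite free_actB free_act_gen gen_act_vacuum//; case: eqP => _.
    by rewrite free_act1 scale1r subrr.
  by rewrite free_act0 scale0r subrr.
- by rewrite free_actD free_actZ !free_act_gen gen_act_D// addNr.
have genE : gen_act (emode m u v, m + n) f =
    \sum_(j < M) expc m%:~R j *: gen_act (vsa_mode u j v, m + n) f.
  rewrite (emodeE _ hN) -[LHS]/(gen_map hf _ _) linear_sum.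
  by apply: eq_bigr => j _; rewrite linearZ.
rewrite [LHS]free_actB [free_act f (_ - _)]free_actB [free_act f (_ *: _)]free_actZ free_act_sum.
apply: (@etrans _ _ (gen_act (v, n) (gen_act (u, m) f)
    - (-1) ^+ (b && c) *: gen_act (u, m) (gen_act (v, n) f) - _)).
  by congr (_ - _ *: _ - _); apply: free_act_gen2.
rewrite (gen_act_comm _ _ hf hu hv) genE [X in X - _ - _]addrC addrK.
apply/eqP; rewrite subr_eq0; apply/eqP; apply: eq_bigr => j _.
by rewrite free_actZ free_act_gen.
Qed.

End FreeAction.

Section UAction.
Context {K : numFieldType} (V : vertexSuperalgebra K) (N E : lmodType K).
Variable op : bool -> V -> nat -> N -> N.
Hypothesis opP : nonneg_module op.
Implicit Types (u v : V) (f g : word_fun V N E) (p q : U V).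
Local Notation coherent := (@coherent K V N E op).

(** Independent of the representative when [f] is coherent, by [U_act_pi]. *)
Definition U_act f p : word_fun V N E := free_act op f (quotalg_repr p).

Lemma U_act_pi f (p : free_alg K (V * int)%type) : coherent f ->
  U_act f (quotalg_pi (@U_rel K V) p) = free_act op f p.
Proof.
move=> hf; apply/eqP; rewrite -subr_eq0 -free_actB; apply/eqP; apply: (free_act_ideal opP) => //.
by apply/quotalg_piP; rewrite quotalg_reprK.
Qed.

Lemma U_act1 f : coherent f -> U_act f 1 = f.
Proof. by move=> hf; rewrite (U_act_pi 1 hf) free_act1. Qed.

Lemma U_act_gen f u n : coherent f -> U_act f (U_gen u n) = gen_act op (u, n) f.
Proof. by move=> hf; rewrite (U_act_pi _ hf) free_act_gen. Qed.

Lemma U_act_lin f a p q : coherent f -> U_act f (a *: p + q) = a *: U_act f p + U_act f q.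
Proof.
move=> hf; rewrite -[p]quotalg_reprK -[q]quotalg_reprK -linearP !U_act_pi//.
exact: free_act_lin.
Qed.

Lemma U_act0 f : coherent f -> U_act f 0 = 0.
Proof.
by move=> hf; have := U_act_lin (-1) 0 0 hf; rewrite scaler0 addr0 scaleN1r addNr.
Qed.

Lemma coherent_U_act f p : coherent f -> coherent (U_act f p).
Proof. by move=> hf; apply: coherent_free_act. Qed.

Lemma U_actM f p q : coherent f -> U_act f (p * q) = U_act (U_act f p) q.
Proof.
move=> hf; rewrite -[p]quotalg_reprK -[q]quotalg_reprK -rmorphM.
have hp := coherent_free_act opP (quotalg_repr p) hf.
apply: etrans (U_act_pi _ hf) _.
by rewrite free_actM (U_act_pi (quotalg_repr p) hf) (U_act_pi (quotalg_repr q) hp).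
Qed.

End UAction.

(** * The universal coherent function *)

Section Splitting.
Context {K : numFieldType} (V : vertexSuperalgebra K).
Implicit Types (b c : bool) (u v : V) (x : letter V) (y z : nletter V) (p q : U V).
Local Notation A := (U_plus V).
Local Notation W := (U_zero_minus V).
Local Notation N := (subsp W).
Definition split_space : lmodType K := tensor (subsp A) N.
Local Notation E := split_space.
Local Notation op := (@zero_minus_op K V).
Local Notation coherent := (@coherent K V N E op).
Local Opaque U_gen quotalg_mul quotalg_one quot_scale.

(** The pure tensor [p (x) n], extended to all [p] with the value [0 (x) n] outside the subalgebra:
the words below are then plain elements of [U], free of membership proofs. *)
Definition plus_pure p (n : N) : E := pure (insubd (0 : subsp A) p) n.

Lemma plus_pure_val (a : subsp A) n : plus_pure (\val a) n = pure a n.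
Proof. by rewrite /plus_pure valKd. Qed.

Lemma plus_pure_lin a p q n : p \in A -> q \in A ->
  plus_pure (a *: p + q) n = a *: plus_pure p n + plus_pure q n.
Proof.
move=> hp hq; rewrite -[p]/(\val (Subsp hp)) -[q]/(\val (Subsp hq)) -linearP.
rewrite [LHS]plus_pure_val 2!plus_pure_val. exact: pure_linearl.
Qed.

Definition word (s : seq (nletter V)) : U V := foldr (fun y p => U_letter (neg_letter y) * p) 1 s.

Lemma U_letter_neg_plus y : U_letter (neg_letter y) \in A.
Proof. by rewrite U_letterE; apply: mem_subalg; exists (homog_part y.1.1 y.1.2), y.2.+1. Qed.

Lemma word_plus s : word s \in A.
Proof.
elim: s => [|y s IH]; first exact: subalg1.
by apply: subalgM => //; apply: U_letter_neg_plus.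
Qed.

Lemma word_cat s t : word (s ++ t) = word s * word t.
Proof.
elim: s => [|y s IH]; first by rewrite mul1r.
by rewrite /= IH; apply: mulrA.
Qed.

(** [base_fun p] is the function [(w, n) |-> p w (x) n].  It is locked because comparing two of its
values would unfold the tensor product. *)
Fact base_fun_key : unit. Proof. exact: tt. Qed.
Definition base_fun :=
  locked_with base_fun_key (fun p => (fun w n => plus_pure (p * word w) n) : word_fun V N E).

Lemma base_funE p w n : base_fun p w n = plus_pure (p * word w) n.
Proof. by rewrite /base_fun unlock. Qed.

Lemma base_fun_lin a p q : p \in A -> q \in A -> base_fun (a *: p + q) = a *: base_fun p +
  base_fun q.
Proof.
move=> hp hq; apply/funext => w; apply/funext => n; rewrite word_fun_linE !base_funE.
by rewrite mulrDl -U_scaleAl plus_pure_lin//; apply: subalgM => //; apply: word_plus.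
Qed.

Lemma base_fun0 : base_fun 0 = 0.
Proof.
have h0 : 0 \in A by apply: rpred0.
by have := base_fun_lin (-1) h0 h0; rewrite scaler0 addr0 scaleN1r addNr.
Qed.

Lemma base_funZ a p : p \in A -> base_fun (a *: p) = a *: base_fun p.
Proof.
move=> hp; have h0 : 0 \in A by apply: rpred0.
by have := base_fun_lin a hp h0; rewrite base_fun0 !addr0.
Qed.

Lemma act_base_fun p y : act op (base_fun p) (neg_letter y) = base_fun (p * U_letter
  (neg_letter y)).
Proof.
rewrite actN; apply/funext => w; apply/funext => n.
by rewrite /shift !base_funE /= mulrA.
Qed.

Lemma base_fun_shift s p : shift s (base_fun p) = base_fun (p * word s).
Proof. by apply/funext => w; apply/funext => n; rewrite /shift !base_funE word_cat mulrA. Qed.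

Lemma base_fun_nil_linear p : linear (base_fun p [::]).
Proof. by move=> a n n'; rewrite !base_funE; apply: pure_linearr. Qed.

Lemma U_letter_commr p x x' :
  p * U_letter x * U_letter x' = koszul x x' *: (p * U_letter x' * U_letter x) + p * U_letter
    (bracket x x').
Proof.
apply: (etrans (esym (mulrA _ _ _))); rewrite U_letter_comm mulrDr -U_scaleAr.
exact: (congr1 (fun q => koszul x x' *: q + p * U_letter (bracket x x')) (mulrA p (U_letter x')
  (U_letter x))).
Qed.

(** By [act_base_fun], acting on [base_fun p] by letters of negative degree multiplies [p] on the
right by them, so the relations are those of [U]. *)
Lemma base_fun_local p : p \in A -> local_rel op (base_fun p).
Proof.
move=> hp; have hpM y : p * U_letter (neg_letter y) \in A by apply: subalgM => //;
  apply: U_letter_neg_plus.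
split=> [a n n'|c i a u v|c i u|y z].
- exact: base_fun_nil_linear.
- have L : U_letter (neg_letter (c, a *: u + v, i)) = a *: U_letter (neg_letter (c, u, i)) +
  U_letter (neg_letter (c, v, i)).
    exact: U_letter_linear.
  rewrite /= !act_base_fun -(base_fun_lin a (hpM _) (hpM _)) L mulrDr.
  by rewrite -U_scaleAr.
- have L : U_letter (neg_letter (c, vsa_D u, i)) = - (Negz i)%:~R *: U_letter (neg_letter
  (c, u, i)).
    by rewrite scaleNr; apply: U_letter_D.
  by rewrite !act_base_fun L -U_scaleAr (base_funZ _ (hpM _)) scaleNr.
have [r yz] := bracket_neg y z.
have hpMM y1 y2 : p * U_letter (neg_letter y1) * U_letter (neg_letter y2) \in A.
  by apply: subalgM; [apply: hpM | apply: U_letter_neg_plus].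
have -> : act op (base_fun p) (bracket (neg_letter y) (neg_letter z)) = base_fun (p * U_letter
  (bracket (neg_letter y) (neg_letter z))).
  by rewrite yz act_base_fun.
rewrite 4!act_base_fun.
rewrite addrC -scaleNr -(base_fun_lin _ (hpMM _ _) (hpMM _ _)).
(* Stated for variables, since rewriting with the products themselves would unfold them. *)
have cancel (a : K) (X Y Z : U V) : Y = a *: X + Z -> - a *: X + Y = Z.
  by move=> ->; rewrite scaleNr addKr.
exact: (congr1 base_fun (cancel _ _ _ _ (U_letter_commr p (neg_letter y) (neg_letter z)))).
Qed.

Lemma base_fun_coherent p : p \in A -> coherent (base_fun p).
Proof.
move=> hp s; rewrite base_fun_shift; apply: base_fun_local.
by apply: subalgM => //; apply: word_plus.
Qed.

Lemma U_letter_homog_part b u n : U_letter (b, homog_part b u, n) = U_letter (b, u, n).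
Proof. by rewrite !U_letterE /= (homog_part_id (homog_part_homog b u)). Qed.

Lemma gen_act_base_fun p u (i : nat) : p \in A ->
  gen_act op (u, Negz i) (base_fun p) = base_fun (p * U_gen u (Negz i)).
Proof.
move=> hp; have e b : act op (base_fun p) (b, homog_part b u, Negz i) = base_fun (p * U_letter
  (b, u, Negz i)).
  apply: etrans (act_base_fun p (b, homog_part b u, i)) _.
  by rewrite -(U_letter_homog_part b u).
have hM b : p * U_letter (b, u, Negz i) \in A.
  by apply: subalgM => //; apply: (U_letter_neg_plus (b, u, i)).
rewrite /gen_act !e -[X in X + _]scale1r -(base_fun_lin 1 (hM false) (hM true)).
by rewrite scale1r -(mulrDr p) U_letter_sum.
Qed.

Lemma U_act_base_fun p : p \in A -> U_act op (base_fun 1) p = base_fun p.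
Proof.
have g1 : coherent (base_fun 1) by apply: base_fun_coherent; apply: subalg1.
suff H : p \in A -> p \in A /\ U_act op (base_fun 1) p = base_fun p by move=> /H[].
move: p; apply: subalg_ind_right.
- split=> [|a p q [hp Ep] [hq Eq]]; first by rewrite rpred0 base_fun0 (U_act0
  (@zero_minus_module K V)).
  split; first by apply: rpredD => //; apply: rpredZ.
  by rewrite U_act_lin// ?Ep ?Eq ?base_fun_lin//; apply: zero_minus_module.
- by split; [apply: subalg1 | rewrite U_act1//; apply: zero_minus_module].
move=> _ p [u [n [n0 ->]]] [hp Ep].
have hg : U_gen u (- n%:Z) \in A by apply: mem_subalg; exists u, n.
split; first exact: subalgM.
rewrite (U_actM (@zero_minus_module K V))// Ep (U_act_gen (@zero_minus_module K V));
  last exact: base_fun_coherent.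
by case: n n0 hg => [//|i] _ _; apply: gen_act_base_fun.
Qed.

(** The vector [n'] stands for [p n]: that this lies in the subalgebra is the first half of the claim,
and a free [n'] keeps its proof out of the second half. *)
Definition acts_as_mul p := (forall n : N, p * \val n \in W) /\
  forall f, coherent f -> forall n n' : N, \val n' = p * \val n ->
    U_act op f p [::] n = f [::] n'.

Lemma acts_as_mul_subspace : is_subspace acts_as_mul.
Proof.
split=> [|a p q [hp Ep] [hq Eq]].
  split=> [n|f hf n n' En]; first by rewrite mul0r rpred0.
  have -> : n' = 0 by apply: val_inj; rewrite En mul0r.
  rewrite (U_act0 (@zero_minus_module K V) hf).
  have := lr_linear (coherent_local hf) (-1) 0 0.
  by rewrite scaler0 addr0 scaleN1r addNr => ->.
have H n : (a *: p + q) * \val n = a *: (p * \val n) + q * \val n.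
  by rewrite mulrDl -U_scaleAl.
split=> [n|f hf n n' En].
  by rewrite H; apply: rpredD; [apply: rpredZ; apply: hp | apply: hq].
rewrite (U_act_lin (@zero_minus_module K V) _ _ _ hf) word_fun_linE.
have comb (X X' Y Y' : E) : X = X' -> Y = Y' -> a *: X + Y = a *: X' + Y' by move=> -> ->.
have -> : n' = a *: Subsp (hp n) + Subsp (hq n).
  by apply: val_inj; rewrite En H linearP.
rewrite (lr_linear (coherent_local hf)).
exact: (comb _ _ _ _ (Ep f hf n (Subsp (hp n)) erefl) (Eq f hf n (Subsp (hq n)) erefl)).
Qed.

Lemma acts_as_mul1 : acts_as_mul 1.
Proof.
split=> [n|f hf n n' En]; first by rewrite mul1r; apply: subsp_mem.
have -> : n' = n by apply: val_inj; rewrite En mul1r.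
by rewrite (U_act1 (@zero_minus_module K V) hf).
Qed.

(** [f.(pq)] at [n] is [f.p] at [q n], because [f.p] is coherent too, and so [f] at [p q n]. *)
Lemma acts_as_mulM p q : acts_as_mul p -> acts_as_mul q -> acts_as_mul (p * q).
Proof.
move=> [hp Ep] [hq Eq]; split=> [n|f hf n n' En].
  have -> : p * q * \val n = p * (q * \val n) by apply/esym/mulrA.
  exact: (hp (Subsp (hq n))).
rewrite (U_actM (@zero_minus_module K V) _ _ hf).
apply: etrans (Eq _ (coherent_U_act (@zero_minus_module K V) p hf) n (Subsp (hq n)) erefl) _.
by apply: (Ep _ hf); apply: (etrans En); apply/esym/mulrA.
Qed.

Lemma acts_as_mul_gen u (i : nat) : acts_as_mul (U_gen u i%:Z).
Proof.
split=> [n|f hf n n' En]; first by apply: zero_minus_mull; apply: subsp_mem.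
rewrite (U_act_gen (@zero_minus_module K V) _ _ hf) /gen_act.
rewrite -[LHS]/(f [::] (op false (homog_part false u) i n) + f [::] (op true
  (homog_part true u) i n)).
rewrite -[X in X + _]scale1r -(lr_linear (coherent_local hf)).
apply: (congr1 (f [::])); apply: val_inj; rewrite En linearP /= scale1r 2!U_letter_homog_part.
by rewrite -mulrDl U_letter_sum.
Qed.

Lemma acts_as_mul_zero_minus p : p \in W -> acts_as_mul p.
Proof.
have alg : is_subalgebra acts_as_mul.
  by split; [apply: acts_as_mul_subspace | apply: acts_as_mul1 | apply: acts_as_mulM].
move: p; apply: span_sub; first exact: acts_as_mul_subspace.
move=> _ [p [q [hp hq ->]]]; apply: acts_as_mulM.
  by move: p hp; apply: subalg_sub => // _ [u ->]; apply: (acts_as_mul_gen u 0).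
by move: q hq; apply: subalg_sub => // _ [u [n [_ ->]]]; apply: acts_as_mul_gen.
Qed.

End Splitting.

(** * The inverse of the multiplication map *)

Section Inverse.
Context {K : numFieldType} (V : vertexSuperalgebra K).
Implicit Types (b c : bool) (u v : V) (x : letter V) (y z : nletter V) (p q t : U V).
Local Notation A := (U_plus V).
Local Notation W := (U_zero_minus V).
Local Notation N := (subsp W).
Local Notation E := (split_space V).
Local Notation op := (@zero_minus_op K V).
Implicit Types f g : word_fun V N E.

Definition mult : E -> U V := mult_map A W.

Lemma mult_map_linear : linear (mult_map A W).
Proof. exact: linearP. Qed.

Lemma mult_linear : linear mult.
Proof. exact: mult_map_linear. Qed.

Lemma mult_lin a (s t : E) : mult (a *: s + t) = a *: mult s + mult t.
Proof. exact: mult_linear. Qed.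

Lemma mult_pure p n : p \in A -> mult (plus_pure p n) = p * \val n.
Proof.
move=> hp; rewrite -[p]/(\val (Subsp hp)) plus_pure_val.
exact: mult_map_pure.
Qed.

Definition realizes t f := forall w n, mult (f w n) = t * word w * \val n.

Lemma realizes_base : realizes 1 (base_fun 1).
Proof.
move=> w n; rewrite base_funE; apply: mult_pure.
by apply: subalgM; [apply: subalg1 | apply: word_plus].
Qed.

Lemma realizes_shift t f y : realizes t f -> realizes (t * U_letter (neg_letter y)) (act op f
  (neg_letter y)).
Proof.
move=> hf w n; rewrite actN; apply: etrans (hf (y :: w) n) _.
by apply: (congr1 (fun r => r * \val n)); apply: mulrA.
Qed.

(** In [U] the letter [x] really does stand in front of the word: the recursion that defines [act]
repeats the commutation relation of [U]. *)
Lemma realizes_act t f x : realizes t f -> realizes (t * U_letter x) (act op f x).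
Proof.
case: x => -[b u] k hf w n.
elim: w t f hf b u k n => [|y w IH] t f hf b u [i|i] n;
  try exact: (realizes_shift (b, u, i) hf).
  apply: etrans (hf [::] (op b u i n)) _.
  apply: etrans (congr1 (fun q => q * _) (mulr1 t)) _; apply: etrans (mulrA t _ _) _.
  exact: (congr1 (fun q => q * \val n) (esym (mulr1 (t * _)))).
rewrite act_consE mult_lin (IH _ _ (realizes_shift y hf)) (IH _ _ hf).
have comb (a : K) (X Y Z r s : U V) : Z = a *: X + Y ->
    a *: (X * r * s) + Y * r * s = Z * r * s.
  by move=> ->; rewrite !mulrDl -!U_scaleAl.
apply: etrans (comb _ _ _ _ _ _ (U_letter_commr t _ (neg_letter y))) _.
by apply: (congr1 (fun r => r * \val n)); apply/esym/mulrA.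
Qed.

Lemma realizes_free_act t f (r : free_alg K (V * int)%type) : realizes t f ->
  realizes (t * quotalg_pi (@U_rel K V) r) (free_act op f r).
Proof.
elim/(@free_alg_ind K): r t f => [|a r s IHr IHs|[u n] r IHr] t f hf.
- by rewrite free_act1 rmorph1 mulr1.
(* [comb] and [distr] are stated for variables, so that no products get unfolded. *)
- have comb (X X' Y Y' : U V) : X = X' -> Y = Y' -> a *: X + Y = a *: X' + Y' by move=> -> ->.
  have distr (X Y p q : U V) : a *: (t * X * p * q) + t * Y * p * q = t * (a *: X + Y) * p * q.
    by rewrite mulrDr 2!mulrDl -U_scaleAr -2!U_scaleAl.
  move=> w n; rewrite free_act_lin word_fun_linE mult_lin.
  apply: etrans (comb _ _ _ _ (IHr _ _ hf w n) (IHs _ _ hf w n)) _.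
  apply: etrans (distr _ _ _ _) _.
  by apply: (congr1 (fun X => t * X * word w * \val n)); apply/esym/linearP.
rewrite free_act_genM rmorphM mulrA; apply: IHr => w m.
have h b := realizes_act (b, homog_part b u, n) hf w m.
rewrite /gen_act -[X in X + _]scale1r word_fun_linE mult_lin scale1r !h !U_letter_homog_part.
by rewrite -2!mulrDl -mulrDr U_letter_sum.
Qed.

Definition zero_minus_one : N := Subsp (zero_minus1 V).

Definition splitting q : E := U_act op (base_fun 1) q [::] zero_minus_one.

Lemma base_fun1_coherent : coherent op (base_fun (1 : U V)).
Proof. by apply: base_fun_coherent; apply: subalg1. Qed.

Lemma splittingK : cancel splitting mult.
Proof.
move=> q; apply: etrans (realizes_free_act _ realizes_base _ _) _.
by rewrite quotalg_reprK mul1r !mulr1.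
Qed.

Lemma splitting_lin a p q : splitting (a *: p + q) = a *: splitting p + splitting q.
Proof. by rewrite /splitting (U_act_lin (@zero_minus_module K V) _ _ _ base_fun1_coherent). Qed.

(** For a pure tensor, [f_1.(ab) = (f_1.a).b], where [f_1.a] is [(w, n) |-> a w (x) n] and [b] then
carries the vector [1] to [b]. *)
Lemma multK : cancel mult splitting.
Proof.
elim/(@tensor_ind K) => [a n|c s t hs ht]; last first.
  have comb (X X' Y Y' : E) : X = X' -> Y = Y' -> c *: X + Y = c *: X' + Y' by move=> -> ->.
  apply: etrans (congr1 splitting (mult_lin c s t)) _.
  by apply: etrans (splitting_lin c _ _) _; apply: comb.
have -> : mult (pure a n) = \val a * \val n by apply: mult_map_pure.
rewrite /splitting (U_actM (@zero_minus_module K V) _ _ base_fun1_coherent) (U_act_base_fun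
  (subsp_mem a)).
have [_ mul_n] := acts_as_mul_zero_minus (subsp_mem n).
rewrite (mul_n _ (base_fun_coherent (subsp_mem a)) zero_minus_one n); last by rewrite mulr1.
by rewrite base_funE mulr1; apply: plus_pure_val.
Qed.

End Inverse.

Theorem corollary3p5 (R : realType) (V : vertexSuperalgebra R[i]) :
  bijective (mult_map (U_plus V) (U_zero_minus V) :
    {linear tensor (subsp (U_plus V)) (subsp (U_zero_minus V)) -> U V}).
Proof. by exists (@splitting _ V); [apply: multK | apply: splittingK]. Qed.
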